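(* Let $q\ge 1$ and let $X$ be a closed connected definable subset of $\mathbb{R}^q$. Then $X$ is Lipschitz normally embedded in $\mathbb{R}^q$ if and only if $\mathrm{clos}(\sigma_q(X))$, the closure of $\sigma_q(X)$ in $\mathbf{S}^q$, is Lipschitz normally embedded in $\mathbf{S}^q$.
   Context: Fix an o-minimal structure expanding the ordered real field $(\mathbb{R},+,\cdot,\ge)$; ''definable'' means definable in it. $|\cdot|$ is the Euclidean norm. $\mathbf{S}^q$ is the unit sphere of $\mathbb{R}^{q+1}$, with the Euclidean distance of $\mathbb{R}^{q+1}$ restricted to it (equivalently, up to a constant, with its geodesic distance). $N_q=(0,\dots,0,1)\in\mathbb{R}^{q+1}$ and $\sigma_q:\mathbb{R}^q\to\mathbf{S}^q\setminus\{N_q\}$ is the inverse of the stereographic projection from $N_q$: $\sigma_q(x)=\left(\frac{2x}{1+|x|^2},\frac{|x|^2-1}{|x|^2+1}\right)$. Let $(M,d_M)$ be a metric space (here $\mathbb{R}^q$ or $\mathbf{S}^q$) and $S\subset M$. The outer distance $d_S$ is the restriction of $d_M$ to $S\times S$. The inner distance $d_{in}^S(x,x')\in[0,\infty]$ is the infimum of the lengths of the rectifiable paths lying in $S$ joining $x$ and $x'$ ($+\infty$ if there is none). $S$ is Lipschitz normally embedded (LNE) in $M$ if there is a constant $L>0$ with $d_{in}^S(x,x')\le L\,d_S(x,x')$ for all $x,x'\in S$. *)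

(* Defs.v *)
From HB Require Import structures.
From mathcomp Require Import all_boot all_order all_algebra.
From mathcomp Require Import ring lra.
From mathcomp Require Import all_classical all_reals all_analysis.

Set Implicit Arguments.
Unset Strict Implicit.
Unset Printing Implicit Defensive.

Import Order.TTheory GRing.Theory Num.Theory.
Import numFieldTopology.Exports.

Local Open Scope classical_set_scope.
Local Open Scope ring_scope.

(* ['rV[R]_n] carries the sup-norm metric in the library; [euclid R n] has the
   same elements and linear structure but the Euclidean metric. *)
Definition euclid (R : realType) (n : nat) : Type := 'rV[R]_n.

HB.instance Definition _ (R : realType) (n : nat) :=
  GRing.Lmodule.copy (euclid R n) 'rV[R]_n.

Definition enorm (R : realType) (n : nat) (x : euclid R n) : R :=
  Num.sqrt (\sum_(i < n) x 0 i ^+ 2).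

Section euclidean_metric.
Context {R : realType} {n : nat}.
Implicit Types x y z : euclid R n.

Lemma enorm_ge0 x : 0 <= enorm x.
Proof. exact: sqrtr_ge0. Qed.

Lemma enorm_sqr x : enorm x ^+ 2 = \sum_(i < n) x 0 i ^+ 2.
Proof. by rewrite sqr_sqrtr// sumr_ge0// => i _; rewrite sqr_ge0. Qed.

Lemma enorm_eq0 x : enorm x = 0 -> x = 0.
Proof.
move=> x0; have /eqP := enorm_sqr x; rewrite x0 expr0n/= eq_sym.
rewrite psumr_eq0 => [/allP s0|i _]; last exact: sqr_ge0.
apply/rowP => i; rewrite [RHS]mxE; apply/eqP.
by have := s0 i (mem_index_enum _); rewrite /= sqrf_eq0.
Qed.

Lemma enorm0 : enorm (0 : euclid R n) = 0.
Proof.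
by rewrite /enorm big1 ?sqrtr0// => i _; rewrite mxE expr0n.
Qed.

Lemma enormN x : enorm (- x) = enorm x.
Proof. by congr Num.sqrt; apply: eq_bigr => i _; rewrite mxE sqrrN. Qed.

Lemma cauchy_schwarz x y : \sum_(i < n) x 0 i * y 0 i <= enorm x * enorm y.
Proof.
set C := \sum_(i < n) _; set a := enorm x; set b := enorm y.
have [b0|b0] := eqVneq b 0.
  rewrite b0 mulr0 /C (enorm_eq0 b0) big1// => i _.
  by rewrite [X in _ * X]mxE mulr0.
have b_gt0 : 0 < b by rewrite lt_neqAle eq_sym b0 enorm_ge0.
have h : 0 <= \sum_(i < n) (b ^+ 2 * x 0 i - C * y 0 i) ^+ 2.
  by apply: sumr_ge0 => i _; exact: sqr_ge0.
have e : \sum_(i < n) (b ^+ 2 * x 0 i - C * y 0 i) ^+ 2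
    = b ^+ 2 * (b ^+ 2 * a ^+ 2 - C ^+ 2).
  transitivity (\sum_(i < n) (b ^+ 4 * x 0 i ^+ 2
      - (2 * b ^+ 2 * C) * (x 0 i * y 0 i) + C ^+ 2 * y 0 i ^+ 2)).
    by apply: eq_bigr => i _; ring.
  rewrite big_split/= sumrB -!mulr_sumr -!enorm_sqr -/a -/b -/C; ring.
move: h; rewrite e pmulr_rge0 ?exprn_gt0// subr_ge0 => h.
apply: le_trans (ler_norm _) _.
rewrite -(@ler_pXn2r _ 2)// ?nnegrE ?mulr_ge0 ?enorm_ge0//.
by rewrite real_normK ?num_real// exprMn mulrC.
Qed.

Lemma ler_enormD x y : enorm (x + y) <= enorm x + enorm y.
Proof.
rewrite -(@ler_pXn2r _ 2)// ?nnegrE ?addr_ge0 ?enorm_ge0//.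
rewrite sqrrD !enorm_sqr.
rewrite (eq_bigr (fun i => x 0 i ^+ 2 + (x 0 i * y 0 i) *+ 2 + y 0 i ^+ 2)).
  rewrite big_split/= lerD2r big_split/= lerD2l sumrMnl.
  by rewrite ler_pMn2r ?cauchy_schwarz.
by move=> i _; rewrite mxE sqrrD.
Qed.

Definition edist x y : R := enorm (x - y).

Let edistxx x : edist x x = 0.
Proof. by rewrite /edist subrr enorm0. Qed.

Let edist_positivity x y : edist x y = 0 -> x = y.
Proof. by move/enorm_eq0/eqP; rewrite subr_eq0 => /eqP. Qed.

Let edist_sym x y : edist x y = edist y x.
Proof. by rewrite /edist -enormN opprB. Qed.

Let edist_triangle y x z : edist x z <= edist x y + edist y z.
Proof. by rewrite /edist -(subrKA y x (- z)) ler_enormD. Qed.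

HB.instance Definition _ := @isMetric.Build R (euclid R n) edist
  edistxx edist_positivity edist_sym edist_triangle.

End euclidean_metric.

Definition sphere (R : realType) (q : nat) : Type :=
  {x : euclid R (q + 1) | enorm x == 1}.

Section sphere_metric.
Context {R : realType} {q : nat}.
Implicit Types x y z : sphere R q.

HB.instance Definition _ := Choice.copy (sphere R q)
  {x : euclid R (q + 1) | enorm x == 1}.

Definition sphere_dist x y : R := mdist (sval x) (sval y).

Let sphere_distxx x : sphere_dist x x = 0.
Proof. exact: mdistxx. Qed.

Let sphere_dist_positivity x y : sphere_dist x y = 0 -> x = y.
Proof. by move/mdist_positivity => xy; apply: val_inj. Qed.

Let sphere_dist_sym x y : sphere_dist x y = sphere_dist y x.
Proof. exact: metric_sym. Qed.

Let sphere_dist_triangle y x z :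
  sphere_dist x z <= sphere_dist x y + sphere_dist y z.
Proof. exact: metric_triangle. Qed.

HB.instance Definition _ := @isMetric.Build R (sphere R q) sphere_dist
  sphere_distxx sphere_dist_positivity sphere_dist_sym sphere_dist_triangle.

End sphere_metric.

Section stereographic.
Context {R : realType} {q : nat}.

Definition inv_stereo_fun (x : euclid R q) : euclid R (q + 1) :=
  row_mx ((2 / (1 + enorm x ^+ 2)) *: (x : 'rV[R]_q))
         (const_mx ((enorm x ^+ 2 - 1) / (enorm x ^+ 2 + 1)) : 'rV[R]_1).

Lemma enorm_inv_stereo_fun (x : euclid R q) : enorm (inv_stereo_fun x) == 1.
Proof.
rewrite -(@eqrXn2 _ 2)// ?enorm_ge0// expr1n enorm_sqr big_split_ord/= big_ord1.
have e i : (inv_stereo_fun x) 0 (lshift 1 i) ^+ 2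
    = (2 / (1 + enorm x ^+ 2)) ^+ 2 * x 0 i ^+ 2.
  by rewrite /inv_stereo_fun row_mxEl mxE exprMn.
rewrite (eq_bigr _ (fun i _ => e i)) -mulr_sumr -enorm_sqr.
rewrite /inv_stereo_fun row_mxEr mxE.
have s0 : enorm x ^+ 2 + 1 != 0 by rewrite gt_eqF// ltr_wpDl ?sqr_ge0.
have s0' : 1 + enorm x ^+ 2 != 0 by rewrite addrC.
by apply/eqP; field; rewrite ?s0 ?s0'.
Qed.

Definition inv_stereo (x : euclid R q) : sphere R q :=
  exist _ (inv_stereo_fun x) (enorm_inv_stereo_fun x).

End stereographic.

Section LNE.
Context {R : realType} {M : metricType R}.
Implicit Types (S : set M) (x y : M) (g : R -> M).

(* The length of the polygon inscribed in [g] with nodes at [a :: s]; compare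
   [variation] in numfun. *)
Definition polygon_length (a b : R) g (s : seq R) : R :=
  let G := g \o nth b (a :: s) in
  \sum_(0 <= k < size s) mdist (G k) (G k.+1).

Definition curve_length (a b : R) g : \bar R :=
  ereal_sup [set (polygon_length a b g s)%:E | s in itv_partition a b].

Definition is_path_in S x y (a b : R) g : Prop :=
  [/\ a <= b, {within `[a, b], continuous g}, g a = x, g b = y
    & forall t, t \in `[a, b] -> S (g t)].

Definition inner_dist S x y : \bar R :=
  ereal_inf [set l : \bar R | exists a b g,
    [/\ is_path_in S x y a b g, (curve_length a b g < +oo)%E
      & l = curve_length a b g]].

Definition LNE S : Prop :=
  exists2 L : R, 0 < L &
    forall x x', S x -> S x' -> (inner_dist S x x' <= (L * mdist x x')%:E)%E.

End LNE.

(* Van den Dries' axioms; the last one makes every singleton of [R] definable,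
   so definability is with parameters.  A mathcomp [interval] may be open,
   closed, half-open, bounded or not, and reduced to a point. *)
Record omin_structure (R : realType) := OminStructure {
  definable : forall n : nat, set (euclid R n) -> Prop ;
  definableT : forall n, @definable n setT ;
  definableU : forall n (A B : set (euclid R n)),
    definable A -> definable B -> definable (A `|` B) ;
  definableC : forall n (A : set (euclid R n)),
    definable A -> definable (~` A) ;
  definableX : forall m n (A : set (euclid R m)) (B : set (euclid R n)),
    definable A -> definable B ->
    definable [set z : euclid R (m + n) | A (lsubmx z) /\ B (rsubmx z)] ;
  definable_proj : forall n (A : set (euclid R (n + 1))),
    definable A ->
    definable ([set lsubmx z | z in A] : set (euclid R n)) ;
  definable_diag : forall n (i j : 'I_n),
    definable [set x : euclid R n | x 0 i = x 0 j] ;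
  definable_add : definable [set x : euclid R 3 | x 0 0 + x 0 1 = x 0 2] ;
  definable_mul : definable [set x : euclid R 3 | x 0 0 * x 0 1 = x 0 2] ;
  definable_le : definable [set x : euclid R 2 | x 0 0 <= x 0 1] ;
  o_minimality : forall A : set (euclid R 1),
    definable A <->
    exists s : seq (interval R),
      A = [set x : euclid R 1 | exists2 I, I \in s & x 0 0 \in I]
}.

(* Main.v *)
Require Import Defs.
From HB Require Import structures.
From mathcomp Require Import all_boot all_order all_algebra.
From mathcomp Require Import ring lra.
From mathcomp Require Import all_classical all_reals all_analysis.

(** The inverse stereographic projection s satisfies
    d(s x, s y) = 2 |x - y| / (<x> <y>) and d(s x, N) = 2 / <x>, where
    <x> = sqrt (1 + |x|^2) is [bracket x]. Hence, as long as a path starting at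
    x is short compared with <x>, its Euclidean length and <x>^2 / 2 times its
    spherical length are comparable, and being Lipschitz normally embedded
    means the same on both sides for pairs of points with |x - y| small
    compared with <x> ([lip_path_inv_stereo], [lip_path_local]).

    For the other pairs |x - y| is of order <x> + <y>, and d(s x, s y) is of
    order 1 / <x> + 1 / <y>. On the sphere it is therefore enough to join each
    s x to the north pole by a path of length O(1 / <x>) ([lip_path_north]),
    and in the Euclidean space to join each x to a fixed base point by a path
    of length O(<x>) ([LNE_of_inv_stereo]). In both cases one moves from x to a
    point of X whose norm is multiplied, respectively divided, by 1 + eps, at
    distance O(eps |x|), to which the estimate for close pairs applies; the
    lengths of the successive steps form a geometric series. A finite-net
    argument and the connectedness of X take care of the bounded part of X.

    That such steps exist is where o-minimality enters, through
    [asymptotically_conic]: for a fixed direction c, the set of the radii r for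
    which X comes within eps r of the point r c on the sphere of radius r is a
    definable subset of the line, so that X either approaches c at all large
    radii or at none, and finitely many directions c suffice.

    Lengths are handled through 1-Lipschitz maps ([LNE_lip_path]), which are
    easily mapped, glued, and passed to the limit. *)

Set Implicit Arguments.
Unset Strict Implicit.
Unset Printing Implicit Defensive.

Import Order.TTheory GRing.Theory Num.Theory.
Import numFieldTopology.Exports.

Local Open Scope classical_set_scope.
Local Open Scope ring_scope.

(** * Lipschitz paths *)

Lemma min_lip (R : realDomainType) (l s t : R) :
  `|Num.min s l - Num.min t l| <= `|s - t|.
Proof.
have := ler_norm (s - t); have := ler_norm (t - s); rewrite (distrC t s).
move: `|s - t| => d dts dst; rewrite ler_norml.
by case: (leP s l) => ?; case: (leP t l) => ?; apply/andP; split; lra.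
Qed.

Lemma max_lip (R : realDomainType) (l s t : R) :
  `|Num.max l s - Num.max l t| <= `|s - t|.
Proof.
have := ler_norm (s - t); have := ler_norm (t - s); rewrite (distrC t s).
move: `|s - t| => d dts dst; rewrite ler_norml.
by case: (leP l s) => ?; case: (leP l t) => ?; apply/andP; split; lra.
Qed.

Section lipschitz_paths.
Context {R : realType} {M : metricType R}.
Implicit Types (S : set M) (x y z : M) (l : R) (g h : R -> M).

(** Curves are replaced by 1-Lipschitz maps: a rectifiable curve becomes
    one once it is parametrised by arc length. The map is defined on the
    whole line and stays in S there, so that gluing, reversing and
    rescaling need no bookkeeping of parameter intervals; only its
    restriction to [0, l] matters. *)
Definition lip_path S x y l : Prop :=
  0 <= l /\ exists h, [/\ forall t, S (h t),
    forall s t, mdist (h s) (h t) <= `|s - t|, h 0 = x & h l = y].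

Lemma mdist_trans y x z l : mdist x y + mdist y z <= l -> mdist x z <= l.
Proof. by apply: le_trans; exact: metric_triangle. Qed.

Lemma lip_path_refl S x : S x -> lip_path S x x 0.
Proof.
by move=> Sx; split=> //; exists (fun=> x); split=> // s t; rewrite mdistxx.
Qed.

Lemma lip_path_sym S x y l : lip_path S x y l -> lip_path S y x l.
Proof.
move=> [l0 [h [hS hlip h0 hl]]]; split=> //.
exists (fun t => h (l - t)); split=> //; rewrite ?subr0 ?subrr//.
move=> s t; apply: le_trans (hlip _ _) _.
by rewrite opprD addrACA subrr add0r opprK addrC distrC.
Qed.

Lemma lip_path_le S x y l l' : l <= l' -> lip_path S x y l -> lip_path S x y l'.
Proof.
move=> ll' [l0 [h [hS hlip h0 hl]]]; split; first exact: le_trans ll'.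
exists (fun t => h (Num.min t l)); split=> //.
- move=> s t; apply: le_trans (hlip _ _) _.
  exact: min_lip.
- by rewrite min_l.
- by rewrite min_r.
Qed.

Lemma lip_path_glue (c : R) g h : g c = h c ->
  (forall s t, mdist (g s) (g t) <= `|s - t|) ->
  (forall s t, mdist (h s) (h t) <= `|s - t|) ->
  forall s t, mdist (if s <= c then g s else h s) (if t <= c then g t else h t)
    <= `|s - t|.
Proof.
move=> gh glip hlip s t.
case: (leP s c) => sc; case: (leP t c) => tc //.
- apply: (mdist_trans (y := g c)); rewrite [in X in _ + X]gh.
  apply: le_trans (lerD (glip _ _) (hlip _ _)) _.
  rewrite (@ler0_norm _ (s - c)); last lra; rewrite (@ler0_norm _ (c - t)); last lra.
  by rewrite ler0_norm; lra.
- apply: (mdist_trans (y := g c)); rewrite [in X in X + _]gh.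
  apply: le_trans (lerD (hlip _ _) (glip _ _)) _.
  rewrite (@ger0_norm _ (s - c)); last lra; rewrite (@ger0_norm _ (c - t)); last lra.
  by rewrite ger0_norm; lra.
Qed.

Lemma lip_path_trans S y x z l l' :
  lip_path S x y l -> lip_path S y z l' -> lip_path S x z (l + l').
Proof.
move=> [l0 [g [gS glip g0 gl]]] [l'0 [h [hS hlip h0 hl]]].
split; first exact: addr_ge0.
exists (fun t => if t <= l then g t else h (t - l)); split.
- by move=> t; case: ifP.
- apply: (@lip_path_glue l g (fun t => h (t - l))) => //.
    by rewrite subrr h0.
  by move=> s t; apply: le_trans (hlip _ _) _; rewrite opprB addrA subrK.
- by rewrite l0.
- case: ifPn => [ll|_]; last by rewrite addrAC subrr add0r.
  have l'E : l' = 0 by lra.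
  by rewrite l'E addr0 gl -h0 -[in h 0]l'E.
Qed.

End lipschitz_paths.

(** A path of length l stays within distance l of its starting point, so
    the Lipschitz estimate on f is only needed there. This matters because
    neither the inverse stereographic projection nor its inverse distorts
    lengths uniformly: their distortion is controlled only near a given
    point. *)
Lemma lip_path_map (R : realType) (M M' : metricType R) (S : set M)
    (S' : set M') (f : M -> M') (c l : R) (x y : M) : 0 < c ->
  (forall z z', mdist x z <= l -> mdist x z' <= l -> S z -> S z' ->
    S' (f z) /\ mdist (f z) (f z') <= c * mdist z z') ->
  lip_path S x y l -> lip_path S' (f x) (f y) (c * l).
Proof.
move=> c0 fS [l0 [h [hS hlip h0 hl]]].
split; first exact: mulr_ge0 (ltW c0) l0.
have near t : 0 <= t <= l -> mdist x (h t) <= l.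
  move=> /andP[t0 tl]; rewrite -h0; apply: le_trans (hlip _ _) _.
  by rewrite sub0r normrN ger0_norm.
pose k t := Num.max 0 (Num.min (t / c) l).
have kl t : 0 <= k t <= l.
  by rewrite /k le_max lexx/= ge_max l0/= ge_min lexx orbT.
exists (fun t => f (h (k t))); split.
- by move=> t; have [] := fS _ _ (near _ (kl t)) (near _ (kl t)) (hS _) (hS _).
- move=> s t.
  have [_] := fS _ _ (near _ (kl s)) (near _ (kl t)) (hS _) (hS _).
  move=> /le_trans; apply; rewrite -ler_pdivlMl//.
  apply: le_trans (hlip _ _) _.
  rewrite [leRHS](_ : _ = `|s / c - t / c|); last first.
    by rewrite -mulrBl normrM [`|c^-1|]gtr0_norm ?invr_gt0// mulrC.
  rewrite /k; move: (s / c) (t / c) => u v.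
  exact: le_trans (max_lip _ _ _) (min_lip _ _ _).
- by rewrite /k mul0r min_l// max_l// h0.
- by rewrite /k mulrAC divff ?gt_eqF// mul1r min_r// max_r// hl.
Qed.

(** * Length of curves and inner distance *)

Section arc_length.
Context {R : realType} {M : metricType R}.
Implicit Types (S : set M) (x y : M) (a b t : R) (g : R -> M).

Lemma polygon_length_cons a b g t s :
  polygon_length a b g (t :: s) = mdist (g a) (g t) + polygon_length t b g s.
Proof. by rewrite /polygon_length big_nat_recl. Qed.

Lemma polygon_length_rcons a b c g s : itv_partition a c s ->
  polygon_length a b g (rcons s b)
  = polygon_length a c g s + mdist (g c) (g b).
Proof.
elim: s a => [|t s IH] a; last first.
  move=> /itv_partition_cons ts.
  by rewrite rcons_cons !polygon_length_cons IH// addrA.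
move=> /itv_partition_nil ->.
by rewrite polygon_length_cons /polygon_length !big_nil addrC.
Qed.

Lemma curve_length_ge0 a b g : a <= b -> (0 <= curve_length a b g)%E.
Proof.
move=> ab; have [s ps] : exists s, itv_partition a b s.
  have [->|ne] := eqVneq a b; first by exists [::]; split=> /=.
  by exists [:: b]; apply: itv_partition1; rewrite lt_neqAle ne.
apply: (@le_trans _ _ (polygon_length a b g s)%:E).
  by rewrite lee_fin /polygon_length sumr_ge0// => k _; rewrite mdist_ge0.
by apply: ereal_sup_ubound; exists s.
Qed.

Lemma curve_lengthxx a g : curve_length a a g = 0%E.
Proof.
apply/eqP; rewrite eq_le curve_length_ge0// andbT.
apply: ge_ereal_sup => _ [s /itv_partitionxx -> <-].
by rewrite /polygon_length big_nil.
Qed.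

(** Length dominates distance: after the time c the polygon may be
    continued by the chord from c to b. *)
Lemma curve_length_superadd a b c g : a <= c <= b ->
  (curve_length a c g + (mdist (g c) (g b))%:E <= curve_length a b g)%E.
Proof.
move=> /andP[ac]; rewrite le_eqVlt => /predU1P[->|cb].
  by rewrite mdistxx adde0.
rewrite -leeBrDr//; apply: ge_ereal_sup => _ [s ps <-].
rewrite leeBrDr// -EFinD -(polygon_length_rcons _ _ ps).
apply: ereal_sup_ubound; exists (rcons s b) => //.
by rewrite -cats1; apply: itv_partition_cat ps (itv_partition1 cb).
Qed.

Lemma within_continuousP a b g : {within `[a, b], continuous g} ->
  forall t e, a <= t <= b -> 0 < e -> exists2 d, 0 < d &
    forall s, a <= s <= b -> `|t - s| < d -> mdist (g t) (g s) < e.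
Proof.
move=> gc t e tab e0.
have tI : [set` `[a, b]] t by rewrite /= in_itv.
have /metricType_numDomainType.cvgrPdist_lt/(_ _ e0) := (subspace_continuousP _ g).1 gc t tI.
rewrite near_withinE => /nbhs_ballP[d /= d0 dg].
exists d => // s sab ts; apply: dg; last by rewrite /= in_itv.
by rewrite /ball/=.
Qed.

(** Reparametrisation by arc length. With phi t the length of g on [a, t],
    the point at parameter u is g at the last time T u when phi is at most
    u. A priori phi may jump, but if T u < T v, then the times t1 and t2
    just after T u and just before T v satisfy u < phi t1 and phi t2 <= v,
    whence d(g t1, g t2) < v - u, and the continuity of g moves t1 and t2
    to T u and T v. *)
Lemma lip_path_of_path S x y a b g :
  is_path_in S x y a b g -> (curve_length a b g < +oo)%E ->
  lip_path S x y (fine (curve_length a b g)).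
Proof.
move=> [ab /within_continuousP gc ga gb gS] glt.
have cl_fin t : a <= t <= b -> curve_length a t g \is a fin_num.
  move=> tab; have at_ : a <= t by case/andP: tab.
  rewrite ge0_fin_numE ?curve_length_ge0//; apply: le_lt_trans glt.
  apply: le_trans (curve_length_superadd g tab).
  by rewrite leeDl// lee_fin mdist_ge0.
pose phi t := fine (curve_length a t g).
have phiP s t : a <= s -> s <= t -> t <= b ->
    mdist (g s) (g t) <= phi t - phi s.
  move=> as_ st tb.
  have ast : a <= s <= t by rewrite as_.
  have := curve_length_superadd g ast.
  rewrite -(fineK (cl_fin s _)) ?as_ ?(le_trans st)//.
  rewrite -(fineK (cl_fin t _)) ?(le_trans as_)//.
  by rewrite -EFinD lee_fin -/(phi s) -/(phi t); lra.
have phia : phi a = 0 by rewrite /phi curve_lengthxx.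
pose E u := [set t | a <= t <= b /\ (t = a \/ phi t <= u)].
pose T u := sup (E u).
have Ea u : E u a by split; [rewrite lexx|left].
have Esup u : has_sup (E u).
  by split; [exists a|exists b => t [/andP[]]].
have ET u t : E u t -> t <= T u by move=> Et; exact: sup_upper_bound (Esup u) t Et.
have Tab u : a <= T u <= b.
  by rewrite ET// /T ge_sup//; [exists a|move=> t [/andP[]]].
have gT u e : 0 < e -> exists2 t, E u t & mdist (g (T u)) (g t) < e.
  move=> e0; have [d d0 gd] := gc _ e (Tab u) e0.
  have [t Et tT] := sup_adherent d0 (Esup u).
  exists t => //; apply: gd; first by case: Et.
  by rewrite ger0_norm ?subr_ge0 ?ET//; rewrite -/(T u) in tT; lra.
have hlip u v : u <= v -> mdist (g (T u)) (g (T v)) <= v - u.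
  move=> uv; have : T u <= T v.
    by apply: ge_sup; [exists a|move=> t [tab tu]; apply: ET; split=> //;
      case: tu => [->|tu]; [left|right; exact: le_trans uv]].
  rewrite le_eqVlt => /predU1P[->|Tuv]; first by rewrite mdistxx subr_ge0.
  apply/ler_addgt0Pr => e e0; have e20 : 0 < e / 2 by rewrite divr_gt0.
  have [d d0 gd] := gc _ _ (Tab u) e20.
  have [d' d'0 gd'] := gc _ _ (Tab v) e20.
  pose m := (T u + T v) / 2.
  have [t2 Et2 t2T] : exists2 t, E v t & T v - Num.min d' (T v - m) < t.
    by apply: sup_adherent (Esup v); rewrite lt_min d'0/= /m; lra.
  have /andP[Tua Tub] := Tab u; have /andP[Tva Tvb] := Tab v.
  have t2le := ET _ _ Et2; case: (Et2) => /andP[at2 t2b] phit2.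
  pose t1 := Num.min m (T u + d / 2).
  have t1u : T u < t1 by rewrite lt_min /m; apply/andP; split; lra.
  have t1m : t1 <= m by rewrite ge_min lexx.
  have t1d : t1 <= T u + d / 2 by rewrite ge_min lexx orbT.
  have [t2d t2m] : T v - d' < t2 /\ m < t2.
    by move: t2T; case: (leP d' (T v - m)) => ? ?; split; lra.
  have t1ab : a <= t1 <= b by apply/andP; split; lra.
  have phit1 : u < phi t1.
    rewrite ltNge; apply/negP => pu; suff : t1 <= T u by rewrite leNgt t1u.
    by apply: ET; split=> //; right.
  have {}phit2 : phi t2 <= v.
    by case: phit2 => // t2a; move: t2m; rewrite t2a /m; lra.
  apply: (mdist_trans (y := g t1)).
  have g1 : mdist (g (T u)) (g t1) < e / 2.
    by apply: gd => //; rewrite ler0_norm; lra.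
  have g2 : mdist (g (T v)) (g t2) < e / 2.
    apply: gd'; first by rewrite at2.
    by rewrite ger0_norm; lra.
  have g12 : mdist (g t1) (g t2) <= phi t2 - phi t1.
    by apply: phiP => //; [case/andP: t1ab|lra].
  have := metric_triangle (g t1) (g t2) (g (T v)).
  by rewrite (metric_sym (g t2)); lra.
split; first by rewrite fine_ge0// curve_length_ge0.
exists (fun u => g (T u)); split.
- by move=> u; apply: gS; rewrite in_itv/=.
- move=> u v; case: (leP u v) => uv.
    by rewrite ler0_norm ?subr_le0// opprB hlip.
  by rewrite metric_sym ger0_norm ?subr_ge0 ?hlip// ltW.
- apply/esym/mdist_positivity/eqP; rewrite eq_le mdist_ge0 andbT.
  apply/ler_addgt0Pr => e e0; have [t [tab ta]] := gT 0 e e0.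
  move=> /ltW gTt; rewrite add0r; apply: (mdist_trans (y := g t)).
  have : mdist x (g t) <= 0.
    case: ta => [->|t0]; first by rewrite -ga mdistxx.
    by case/andP: tab => ? ?; rewrite -ga (le_trans (phiP _ _ _ _ _))// phia; lra.
  by rewrite (metric_sym (g t)); lra.
- rewrite -gb; congr g; apply/eqP; rewrite eq_le; have /andP[_ ->] := Tab (phi b).
  by rewrite ET//; split; [rewrite ab/=|right].
Qed.

Lemma inner_dist_lip_path S x y l :
  lip_path S x y l -> (inner_dist S x y <= l%:E)%E.
Proof.
move=> [l0 [h [hS hlip h0 hl]]].
have hlen : (curve_length 0 l h <= l%:E)%E.
  apply: ge_ereal_sup => _ [s ps <-]; rewrite lee_fin -[leRHS]subr0.
  elim: s 0 ps {h0} => [|t s IH] a ps.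
    by rewrite (itv_partition_nil ps) subrr /polygon_length big_nil.
  have at_ : a <= t by case: ps => /= /andP[/ltW].
  rewrite polygon_length_cons; have := IH _ (itv_partition_cons ps).
  by have := hlip a t; rewrite ler0_norm; lra.
apply: le_trans (hlen); apply: ereal_inf_lbound; exists 0, l, h; split=> //.
  split=> //.
  apply: continuous_subspaceT => t.
  apply/metricType_numDomainType.cvgrPdist_lt => e e0.
  by apply/nbhs_ballP; exists e => //= s ts; exact: le_lt_trans ts.
exact: le_lt_trans hlen (ltry _).
Qed.

(** The infimum defining the inner distance need not be attained, so the
    constant is doubled to leave room for an actual path. There is no room
    when x = y, but then the constant path will do. *)
Lemma LNE_lip_path S : LNE S <-> exists2 L : R, 0 < L &
  forall x y, S x -> S y -> lip_path S x y (L * mdist x y).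
Proof.
split=> -[L L0 SL]; last first.
  by exists L => // x y Sx Sy; exact/inner_dist_lip_path/SL.
exists (2 * L) => [|x y Sx Sy]; first by rewrite mulr_gt0.
have [<-|/eqP] := pselect (x = y).
  by rewrite mdistxx mulr0; exact: lip_path_refl.
rewrite -mdist_gt0 => xy.
have : (inner_dist S x y < (2 * L * mdist x y)%:E)%E.
  apply: le_lt_trans (SL _ _ Sx Sy) _; rewrite lte_fin ltr_pM2r//; lra.
move=> /ereal_inf_lt[_ [a [b [g [pg glt ->]]]]] gl.
apply: lip_path_le (lip_path_of_path pg glt).
rewrite -lee_fin fineK ?ltW//.
by rewrite ge0_fin_numE// curve_length_ge0//; case: pg.
Qed.

End arc_length.

(** * Stereographic projection *)

Section euclidean_norm.
Context {R : realType} {n : nat}.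
Implicit Types x y z : euclid R n.

Lemma mdist_euclid x y : mdist x y = enorm (x - y).
Proof. by []. Qed.

Lemma enormZ (a : R) x : enorm (a *: x) = `|a| * enorm x.
Proof.
rewrite /enorm -sqrtr_sqr -sqrtrM ?sqr_ge0// mulr_sumr.
by congr Num.sqrt; apply: eq_bigr => i _; rewrite mxE exprMn.
Qed.

Lemma sum_sqr_comb (a b : R) x y :
  \sum_(i < n) (a * x 0 i - b * y 0 i) ^+ 2 =
  a ^+ 2 * enorm x ^+ 2 - 2 * a * b * \sum_(i < n) x 0 i * y 0 i
  + b ^+ 2 * enorm y ^+ 2.
Proof.
rewrite !enorm_sqr !mulr_sumr -sumrB -big_split/=.
by apply: eq_bigr => i _; ring.
Qed.

Lemma enormB_le x y : enorm x - enorm y <= enorm (x - y).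
Proof. by have := ler_enormD (x - y) y; rewrite subrK; lra. Qed.

(** The norm of (1, x). The stereographic metric is conformal to the
    Euclidean one with factor 2 / (bracket x)^2, and bracket, unlike the
    norm, is bounded away from 0. *)
Definition bracket x : R := Num.sqrt (1 + enorm x ^+ 2).

Lemma bracket_sqr x : bracket x ^+ 2 = 1 + enorm x ^+ 2.
Proof. by rewrite sqr_sqrtr// addr_ge0 ?sqr_ge0. Qed.

Lemma bracket_ge1 x : 1 <= bracket x.
Proof. by rewrite -[leLHS]sqrtr1 ler_wsqrtr// lerDl sqr_ge0. Qed.

Lemma bracket_gt0 x : 0 < bracket x.
Proof. exact: lt_le_trans (bracket_ge1 x). Qed.

Lemma enorm_le_bracket x : enorm x <= bracket x.
Proof.
rewrite -(@ler_pXn2r _ 2)// ?nnegrE ?enorm_ge0 ?(ltW (bracket_gt0 x))//.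
by rewrite bracket_sqr lerDr.
Qed.

Lemma bracket_le x (r : R) : enorm x <= r -> bracket x <= 1 + r.
Proof.
move=> xr; have x0 := enorm_ge0 x.
rewrite -(@ler_pXn2r _ 2)// ?nnegrE ?(ltW (bracket_gt0 x))//; last lra.
rewrite bracket_sqr; nra.
Qed.

Lemma bracket_lip x y : bracket x <= bracket y + mdist x y.
Proof.
have y0 := bracket_gt0 y; have d0 := enorm_ge0 (x - y); have x0 := enorm_ge0 x.
rewrite mdist_euclid.
rewrite -(@ler_pXn2r _ 2)// ?nnegrE ?(ltW (bracket_gt0 x))//; last lra.
rewrite sqrrD !bracket_sqr.
have := enorm_le_bracket y; have := enormB_le x y; have := enorm_ge0 y.
move: (bracket y) (enorm _) (enorm _) (enorm _) d0 x0 y0 => w d x' y'; nra.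
Qed.

End euclidean_norm.

Section stereographic_distance.
Context {R : realType} {q : nat}.
Implicit Types (x y : euclid R q) (u v : sphere R q).

Lemma enorm_row_mx (u v : 'rV[R]_q) (a b : R) :
  enorm (row_mx u (const_mx a : 'rV[R]_1)
    - row_mx v (const_mx b : 'rV[R]_1) : euclid R (q + 1)) ^+ 2
  = \sum_(i < q) (u 0 i - v 0 i) ^+ 2 + (a - b) ^+ 2.
Proof.
rewrite opp_row_mx add_row_mx enorm_sqr big_split_ord/= big_ord1 row_mxEr !mxE.
by congr (_ + _); apply: eq_bigr => i _; rewrite row_mxEl !mxE.
Qed.

(** The identity is global, not merely infinitesimal: it compares chords,
    hence lengths of polygons, without any calculus. *)
Lemma mdist_inv_stereo x y : mdist (inv_stereo x) (inv_stereo y)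
  = 2 * mdist x y / (bracket x * bracket y).
Proof.
have wx := bracket_gt0 x; have wy := bracket_gt0 y.
apply/eqP; rewrite -(@eqrXn2 _ 2)//; last 2 first.
- exact: mdist_ge0.
- by rewrite mulr_ge0 ?invr_ge0 ?mulr_ge0 ?mdist_ge0 ?ltW.
rewrite [mdist (inv_stereo x) _]/(enorm (inv_stereo_fun x - inv_stereo_fun y)).
rewrite enorm_row_mx.
under eq_bigr do rewrite 2!mxE.
have -> : (2 * mdist x y / (bracket x * bracket y)) ^+ 2
    = 4 * mdist x y ^+ 2 / (bracket x ^+ 2 * bracket y ^+ 2).
  by field; rewrite !gt_eqF.
rewrite sum_sqr_comb !bracket_sqr mdist_euclid.
have -> : enorm (x - y) ^+ 2
    = enorm x ^+ 2 - 2 * \sum_(i < q) x 0 i * y 0 i + enorm y ^+ 2.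
  have := sum_sqr_comb 1 1 x y; rewrite expr1n !mul1r !mulr1 => <-.
  by rewrite enorm_sqr; apply: eq_bigr => i _; rewrite !mxE !mul1r.
have sx : 0 < 1 + enorm x ^+ 2 by rewrite ltr_wpDr ?sqr_ge0.
have sy : 0 < 1 + enorm y ^+ 2 by rewrite ltr_wpDr ?sqr_ge0.
by apply/eqP; field; rewrite ?[_ + 1]addrC !gt_eqF.
Qed.

Lemma inv_stereo_inj : injective (@inv_stereo R q).
Proof.
move=> x y e; apply: mdist_positivity; apply/eqP.
have := mdist_inv_stereo x y; rewrite e mdistxx => /esym/eqP.
rewrite mulf_eq0 invr_eq0 !mulf_eq0 !(gt_eqF (bracket_gt0 _))/= orbF.
by rewrite pnatr_eq0.
Qed.

Definition north_vec : euclid R (q + 1) :=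
  row_mx (0 : 'rV[R]_q) (const_mx 1 : 'rV[R]_1).

Lemma enorm_north_vec : enorm north_vec == 1.
Proof.
rewrite -(@eqrXn2 _ 2)// ?enorm_ge0// expr1n; apply/eqP.
rewrite enorm_sqr big_split_ord/= big_ord1 row_mxEr !mxE expr1n big1 ?add0r//.
by move=> i _; rewrite row_mxEl mxE expr0n.
Qed.

Definition north : sphere R q := exist _ north_vec enorm_north_vec.

Lemma mdist_north x : mdist (inv_stereo x) north = 2 / bracket x.
Proof.
have wx := bracket_gt0 x.
apply/eqP; rewrite -(@eqrXn2 _ 2)//; last 2 first.
- exact: mdist_ge0.
- by rewrite divr_ge0 ?ltW.
rewrite [mdist (inv_stereo x) _]/(enorm (inv_stereo_fun x - north_vec)).
rewrite enorm_row_mx.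
under eq_bigr do rewrite 2!mxE subr0 exprMn.
have -> : (2 / bracket x) ^+ 2 = 4 / bracket x ^+ 2 by field; rewrite gt_eqF.
rewrite -mulr_sumr -enorm_sqr bracket_sqr.
have sx : 0 < 1 + enorm x ^+ 2 by rewrite ltr_wpDr ?sqr_ge0.
by apply/eqP; field; rewrite ?[_ + 1]addrC !gt_eqF.
Qed.

Lemma north_neq_inv_stereo x : inv_stereo x <> north.
Proof.
move=> e; have /eqP := mdist_north x.
rewrite e mdistxx eq_sym mulf_eq0 invr_eq0 (gt_eqF (bracket_gt0 x)) orbF.
by rewrite pnatr_eq0.
Qed.

Lemma inv_stereo_surj u : u <> north -> exists x, inv_stereo x = u.
Proof.
case: u => [u u1] uN.
pose a : 'rV[R]_q := lsubmx u; pose b : R := (rsubmx u : 'rV_1) 0 0.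
have uE : u = row_mx a (const_mx b).
  by rewrite -[LHS]hsubmxK; congr row_mx; apply/rowP => i; rewrite ord1 [RHS]mxE.
have ab : \sum_(i < q) a 0 i ^+ 2 + b ^+ 2 = 1.
  have : enorm (u : euclid R (q + 1)) ^+ 2 = 1 by rewrite (eqP u1) expr1n.
  rewrite enorm_sqr big_split_ord/= big_ord1 uE row_mxEr mxE => <-.
  by congr (_ + _); apply: eq_bigr => i _; rewrite row_mxEl.
have a_sqr : enorm (a : euclid R q) ^+ 2 = 1 - b ^+ 2 by rewrite enorm_sqr -ab addrK.
have b1 : b != 1.
  apply: contra_notN uN => /eqP b1; apply: val_inj => /=.
  rewrite uE b1 /north_vec; congr row_mx; apply: (@enorm_eq0 _ _ (a : euclid R q)).
  by apply/eqP; rewrite -sqrf_eq0 a_sqr b1 expr1n subrr.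
have b1' : 1 - b != 0 by rewrite subr_eq0 eq_sym.
exists ((1 - b)^-1 *: a); apply: val_inj => /=; rewrite uE.
have e : enorm ((1 - b)^-1 *: a : euclid R q) ^+ 2 = (1 + b) / (1 - b).
  by rewrite enormZ exprMn real_normK ?num_real// a_sqr; field.
rewrite /inv_stereo_fun e; congr row_mx.
  rewrite scalerA (_ : _ * _ = 1) ?scale1r//.
  by field; rewrite b1' /= (_ : _ + _ = 2) ?pnatr_eq0//; ring.
congr const_mx; field.
by rewrite b1' /= (_ : _ + _ = 2) ?pnatr_eq0//; ring.
Qed.

End stereographic_distance.

(** * Definable sets and formulas *)

Section definability.
Context {R : realType} (O : omin_structure R).
Implicit Types (n m : nat) (e : nat -> R) (P Q : (nat -> R) -> Prop).

Definition env_prefix n e : euclid R n := \row_(i < n) e i.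

(** Subsets of R^n are handled as predicates on infinite assignments that
    depend on the first n variables. Renaming, inserting or shifting
    variables is then composition with a map of nat, and no cast between
    R^(n + m) and R^(m + n) ever appears. *)
Definition definable_upto n P : Prop :=
  exists2 A : set (euclid R n), definable O A & forall e, P e <-> A (env_prefix n e).

Definition definable_pred P : Prop := exists n, definable_upto n P.

Lemma definableI n (A B : set (euclid R n)) :
  definable O A -> definable O B -> definable O (A `&` B).
Proof.
move=> dA dB; rewrite -[A `&` B]setCK setCI; apply: definableC.
by apply: definableU; exact: definableC.
Qed.

Lemma definable_bigI n (I : finType) (A : I -> set (euclid R n)) :
  (forall i, definable O (A i)) -> definable O [set x | forall i, A i x].
Proof.
move=> dA.
suff dAs (s : seq I) : definable O [set x | forall i, i \in s -> A i x].
  rewrite (_ : [set x | _] = [set x | forall i, i \in enum I -> A i x]) //.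
  by apply/seteqP; split=> x Ax i *; apply: Ax; rewrite ?mem_enum.
elim: s => [|i s IH].
  by rewrite (_ : [set x | _] = setT); [exact: definableT|apply/seteqP; split].
rewrite (_ : [set x | _] = A i `&` [set x | forall i, i \in s -> A i x]).
  exact: definableI.
apply/seteqP; split=> x /=.
  by move=> Ax; split=> [|j js]; apply: Ax; rewrite inE ?eqxx ?js ?orbT.
by move=> [Ai As] j; rewrite inE => /predU1P[->//|/As].
Qed.

Lemma lsubmx_env_prefix n m e : lsubmx (env_prefix (n + m) e) = env_prefix n e.
Proof. by apply/rowP => i; rewrite !mxE. Qed.

Lemma rsubmx_env_prefix n m e :
  rsubmx (env_prefix (n + m) e) = env_prefix m (fun i => e (n + i)%N).
Proof. by apply/rowP => i; rewrite !mxE. Qed.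

Lemma definable_upto_le n m P :
  (n <= m)%N -> definable_upto n P -> definable_upto m P.
Proof.
move=> /subnKC <-; move: (m - n)%N => k [A dA PA].
exists [set z : euclid R (n + k) | A (lsubmx z) /\ setT (rsubmx z)].
  exact: definableX dA (definableT _ _).
by move=> e /=; rewrite lsubmx_env_prefix PA; split=> [|[]].
Qed.

Lemma definable_upto_ext n P Q : (forall e, P e <-> Q e) ->
  definable_upto n P -> definable_upto n Q.
Proof. by move=> PQ [A dA PA]; exists A => // e; rewrite -PQ. Qed.

Lemma definable_pred_ext P Q : (forall e, P e <-> Q e) ->
  definable_pred P -> definable_pred Q.
Proof. by move=> PQ [n dP]; exists n; apply: definable_upto_ext dP. Qed.

Lemma definable_predI P Q : definable_pred P -> definable_pred Q ->
  definable_pred (fun e => P e /\ Q e).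
Proof.
move=> [n dP] [m dQ].
have [A dA PA] := definable_upto_le (leq_maxl n m) dP.
have [B dB QB] := definable_upto_le (leq_maxr n m) dQ.
by exists (maxn n m), (A `&` B); [exact: definableI|move=> e; rewrite PA QB].
Qed.

Lemma definable_upto_proj n m P : definable_upto (n + m) P ->
  definable_upto n (fun e =>
    exists e', (forall i, (i < n)%N -> e' i = e i) /\ P e').
Proof.
elim: m P => [|m IH] P.
  rewrite addn0 => -[A dA PA]; exists A => // e; split=> [[e' [e'e /PA]]|Ae].
    by congr A; apply/rowP => i; rewrite !mxE e'e.
  by exists e; split=> //; exact/PA.
rewrite addnS -addn1 => -[A dA PA].
pose Q e := exists e', (forall i, (i < n + m)%N -> e' i = e i) /\ P e'.
have /IH : definable_upto (n + m) Q.
  exists [set lsubmx z | z in A]; first exact: definable_proj.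
  move=> e; split=> [[e' [e'e /PA Ae']]|[z Az ze]].
    exists (env_prefix (n + m + 1) e') => //; rewrite lsubmx_env_prefix.
    by apply/rowP => i; rewrite !mxE e'e.
  pose e' i := if insub i is Some j then z 0 j else 0.
  have e'z : env_prefix _ e' = z by apply/rowP => i; rewrite !mxE /e' valK.
  exists e'; split; last by apply/PA; rewrite e'z.
  move=> i im; have := lsubmx_env_prefix (n + m) 1 e'.
  rewrite e'z ze => /rowP/(_ (Ordinal im)).
  by rewrite !mxE.
apply: definable_upto_ext => e; split=> [[e1 [e1e [e2 [e21 Pe2]]]]|[e' [e'e Pe']]].
  by exists e2; split=> // i im; rewrite e21 ?e1e// ltn_addr.
by exists e'; split=> //; exists e'.
Qed.

(** Variables may be renamed, identified or permuted at will: copies of the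
    variables s 0, ..., s (m - 1) are appended as m fresh last coordinates
    by means of diagonal sets, P is imposed on the copies, and these are
    projected away. *)
Lemma definable_pred_reindex (s : nat -> nat) P :
  definable_pred P -> definable_pred (fun e => P (e \o s)).
Proof.
move=> [m [A dA PA]].
pose n := (\max_(j < m) s j).+1.
have sn (j : 'I_m) : (s j < n)%N by rewrite ltnS (leq_bigmax (F := s \o val)).
pose Q e := A (env_prefix m (fun i => e (n + i)%N)) /\
  forall j : 'I_m, e (n + j)%N = e (s j).
have /definable_upto_proj dQ : definable_upto (n + m) Q.
  pose B := [set z : euclid R (n + m) | setT (lsubmx z) /\ A (rsubmx z)].
  pose C := [set z : euclid R (n + m) |
    forall j : 'I_m, z 0 (rshift n j) = z 0 (lshift m (Ordinal (sn j)))].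
  exists (B `&` C).
    apply: definableI; first exact: definableX (definableT _ _) dA.
    by apply: definable_bigI => j; exact: definable_diag.
  move=> e; rewrite /Q /B /C /= rsubmx_env_prefix; split=> [[? es]|[[_ ?] es]].
    by split=> // j; rewrite !mxE/= es.
  by split=> // j; have := es j; rewrite !mxE.
exists n; apply: definable_upto_ext dQ => e; split.
  move=> [e' [e'e [Ae' e's]]]; apply/PA; move: Ae'.
  by congr A; apply/rowP => j; rewrite !mxE e's e'e.
move=> /PA Ae; exists (fun i => if (i < n)%N then e i else e (s (i - n)%N)).
split=> [i ->//|]; split; last by move=> j; rewrite ltnNge leq_addr/= addKn sn.
by move: Ae; congr A; apply/rowP => j; rewrite !mxE ltnNge leq_addr/= addKn.
Qed.

(** The assignment in which t becomes the variable 0 and all others move up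
    by one; it makes the quantified variable of a formula always the
    variable 0. *)
Definition scons (t : R) e i := if i is j.+1 then e j else t.

(** Projections eliminate the last coordinate whereas the quantified
    variable is the first: it is first moved to a position n beyond all
    variables of P. *)
Lemma definable_pred_ex P :
  definable_pred P -> definable_pred (fun e => exists t, P (scons t e)).
Proof.
move=> [n [A dA PA]].
pose s i := if i is j.+1 then j else n.
have dP : definable_pred (fun e => P (e \o s)).
  by apply: definable_pred_reindex; exists n, A.
have {dP} [m dP] := dP.
have /definable_upto_proj dQ := definable_upto_le (leq_addl n m) dP.
exists n; apply: definable_upto_ext dQ => e; split.
  move=> [e' [e'e /PA Ae']]; exists (e' n); apply/PA; move: Ae'.
  congr A; apply/rowP => -[[|i] ilt]; rewrite !mxE//=.
  by rewrite e'e// ltnW.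
move=> [t /PA At]; exists (fun i => if i == n then t else e i).
split=> [i ilt|]; first by rewrite ltn_eqF.
apply/PA; move: At; congr A; apply/rowP => -[[|i] ilt]; rewrite !mxE/= ?eqxx//.
by rewrite ltn_eqF// ltnW.
Qed.

(** Terms enter formulas through their graphs, the value being variable 0;
    they are then substituted by quantifying over their values. *)
Definition definable_term (t : (nat -> R) -> R) : Prop :=
  definable_pred (fun e => e 0%N = t (fun i => e i.+1)).

Lemma definable_term_var i : definable_term (fun e => e i).
Proof.
exists (i.+2), [set x : euclid R i.+2 | x 0 0 = x 0 (inord i.+1)].
  exact: definable_diag.
by move=> e /=; rewrite !mxE inordK.
Qed.

Lemma definable_term_const (c : R) : definable_term (fun=> c).
Proof.
exists 1%N, [set x : euclid R 1 | x 0 0 = c].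
  apply/o_minimality; exists [:: `[c, c]%R].
  apply/seteqP; split=> x /=.
    by move=> ->; exists `[c, c]%R; rewrite ?inE// in_itv/= lexx.
  move=> [I]; rewrite inE => /eqP ->; rewrite in_itv/= => xc.
  by apply/eqP; rewrite eq_le andbC.
by move=> e; rewrite /= mxE.
Qed.

Lemma definable_pred_subst2 (t u : (nat -> R) -> R) (F : R -> R -> R -> Prop) :
  definable_term t -> definable_term u ->
  definable_pred (fun e => F (e 0%N) (e 1%N) (e 2%N)) ->
  definable_pred (fun e => F (t (fun i => e i.+1)) (u (fun i => e i.+1)) (e 0%N)).
Proof.
move=> dt du dF.
have d1 := definable_pred_reindex (fun i => if i is j.+1 then j.+3 else 0%N) dt.
have d2 := definable_pred_reindex (fun i => if i is j.+1 then j.+3 else 1%N) du.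
have d3 := definable_predI d1 (definable_predI d2 dF).
apply: definable_pred_ext (definable_pred_ex (definable_pred_ex d3)) => e.
split=> [[a [b /= [bt [au]]]]|Ft]; first by rewrite bt au.
by exists (u (fun i => e i.+1)), (t (fun i => e i.+1)).
Qed.

Lemma definable_term_add t u : definable_term t -> definable_term u ->
  definable_term (fun e => t e + u e).
Proof.
move=> dt du; rewrite /definable_term.
have d : definable_pred (fun e => e 2%N = e 0%N + e 1%N).
  exists 3%N, [set x : euclid R 3 | x 0 0 + x 0 1 = x 0 2].
    exact: definable_add.
  by move=> e /=; rewrite !mxE.
exact: (definable_pred_subst2 (F := fun a b c => c = a + b) dt du d).
Qed.

Lemma definable_term_mul t u : definable_term t -> definable_term u ->
  definable_term (fun e => t e * u e).
Proof.
move=> dt du; rewrite /definable_term.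
have d : definable_pred (fun e => e 2%N = e 0%N * e 1%N).
  exists 3%N, [set x : euclid R 3 | x 0 0 * x 0 1 = x 0 2].
    exact: definable_mul.
  by move=> e /=; rewrite !mxE.
exact: (definable_pred_subst2 (F := fun a b c => c = a * b) dt du d).
Qed.

Lemma definable_pred_le t u : definable_term t -> definable_term u ->
  definable_pred (fun e => t e <= u e).
Proof.
move=> dt du.
have d : definable_pred (fun e => e 0%N <= e 1%N).
  exists 2%N, [set x : euclid R 2 | x 0 0 <= x 0 1]; first exact: definable_le.
  by move=> e /=; rewrite !mxE.
have := definable_pred_subst2 (F := fun a b _ => a <= b) dt du d.
exact: (definable_pred_reindex predn).
Qed.

Lemma definable_term_sum n (t : 'I_n -> (nat -> R) -> R) :
  (forall i, definable_term (t i)) -> definable_term (fun e => \sum_(i < n) t i e).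
Proof.
elim: n t => [|n IH] t dt.
  rewrite (_ : (fun e => _) = fun=> 0); first exact: definable_term_const.
  by apply/funext => e; rewrite big_ord0.
rewrite (_ : (fun e => _) = fun e => t ord0 e + \sum_(i < n) t (lift ord0 i) e).
  by apply: definable_term_add => //; apply: IH => i; exact: dt.
by apply/funext => e; rewrite big_ord_recl.
Qed.

(** The radii r for which the sphere of radius r meets X within relative
    distance sqrt d of the point r c. Squares are used because the norm
    itself is not a polynomial. *)
Lemma definable_near_ray q (X : set (euclid R q)) (c : euclid R q) (d : R) :
  definable O X ->
  definable O [set r : euclid R 1 | exists2 x, X x &
    enorm x = r 0 0 /\ enorm (x - r 0 0 *: c) ^+ 2 <= d * r 0 0 ^+ 2].
Proof.
move=> dX.
pose x e : euclid R q := env_prefix q (fun i => e i.+1).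
have dXx : definable_pred (fun e => X (x e)).
  by apply: (definable_pred_reindex succn (P := fun e => X (env_prefix q e))); exists q, X.
pose sq t e : R := t e * t e.
have dsq t : definable_term t -> definable_term (sq t).
  by move=> dt; apply: definable_term_mul.
pose r e : R := e 0%N.
have dr : definable_term r by exact: definable_term_var.
have dx (i : 'I_q) : definable_term (fun e => e i.+1) by exact: definable_term_var.
pose n1 e := \sum_(i < q) sq (fun e => e i.+1) e.
have dn1 : definable_term n1 by apply: definable_term_sum => i; exact: dsq.
pose n2 e := \sum_(i < q) sq (fun e => e i.+1 + r e * (- c 0 i)) e.
have dn2 : definable_term n2.
  apply: definable_term_sum => i; apply: dsq; apply: definable_term_add => //.
  by apply: definable_term_mul => //; exact: definable_term_const.
have d0 := definable_term_const 0.
have dd : definable_term (fun e => d * sq r e).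
  by apply: definable_term_mul; [exact: definable_term_const|exact: dsq].
have dP := definable_predI (definable_pred_le d0 dr)
  (definable_predI dXx (definable_predI (definable_pred_le dn1 (dsq _ dr))
  (definable_predI (definable_pred_le (dsq _ dr) dn1) (definable_pred_le dn2 dd)))).
have [m {}dP] := dP.
have /definable_upto_proj[A dA PA] := definable_upto_le (leq_addl 1 m) dP.
rewrite (_ : [set r | _] = A)//; apply/seteqP.
have n1E e : n1 e = enorm (x e) ^+ 2.
  by rewrite enorm_sqr; apply: eq_bigr => i _; rewrite !mxE expr2.
have n2E e : n2 e = enorm (x e - r e *: c) ^+ 2.
  by rewrite enorm_sqr; apply: eq_bigr => i _; rewrite /sq !mxE expr2 mulrN.
have sqE e : sq r e = r e ^+ 2 by rewrite expr2.
split=> [s [y Xy [ys yc]]|s As].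
  pose e i : R := if i is j.+1 then if insub j is Some k then y 0 k else 0
    else s 0 0.
  have xe : x e = y by apply/rowP => i; rewrite !mxE /e valK.
  have <- : env_prefix 1 e = s by apply/rowP => i; rewrite !mxE ord1.
  apply/PA; exists e; split=> //.
  by rewrite xe n1E n2E sqE xe /r/= -ys !lexx enorm_ge0 ys.
have /PA[e' [e's]] : A (env_prefix 1 (fun=> s 0 0)).
  by move: As; congr A; apply/rowP => i; rewrite !mxE ord1.
have {}e's : r e' = s 0 0 by rewrite /r e's.
rewrite n1E n2E sqE e's => -[s0 [Xx [xs [sx xc]]]].
exists (x e') => //; split=> //.
apply/eqP; rewrite -(@eqrXn2 _ 2)// ?enorm_ge0//.
by rewrite eq_le xs sx.
Qed.

(** A finite union of intervals contains a neighbourhood of +oo or misses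
    one. *)
Lemma definable_eventually (A : set (euclid R 1)) : definable O A ->
  exists r0 : R, (forall r : euclid R 1, r0 <= r 0 0 -> A r)
    \/ (forall r : euclid R 1, r0 <= r 0 0 -> ~ A r).
Proof.
move=> /o_minimality[s ->].
elim: s => [|[l u] s [r0 IH]]; first by exists 0; right=> r _ [].
case: IH => IH; first by exists r0; left=> r /IH[I Is rI]; exists I; rewrite // inE Is orbT.
have [[r1 Ir1]|[r1 Ir1]] : (exists r1, forall r, r1 <= r -> r \in Interval l u)
    \/ (exists r1, forall r, r1 <= r -> r \notin Interval l u).
  case: u => [b u|[]].
  - right; exists (u + 1) => r ur; rewrite in_itv.
    by apply/negP => /andP[_]; case: b => /= ?; lra.
  - by right; exists 0 => r _; rewrite in_itv andbF.
  - case: l => [b l|[]].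
    + left; exists (l + 1) => r lr; rewrite in_itv andbT.
      by case: b => /=; lra.
    + by left; exists 0.
    + by right; exists 0.
- by exists r1; left=> r /Ir1 rI; exists (Interval l u) => //; rewrite inE eqxx.
- exists (Num.max r0 r1); right=> r; rewrite ge_max => /andP[rr0 rr1] [I].
  rewrite inE => /predU1P[->|Is rI]; first exact/negP/Ir1.
  by apply: (IH r rr0); exists I.
Qed.

End definability.

(** * Definable sets at infinity *)

(** A cubic grid of mesh delta; a point is sent to the lower corner of its
    cube, whose distance is at most sqrt n * delta. *)
Lemma finite_net (R : realType) (n : nat) (B eta : R) : 0 < eta ->
  exists cs : seq (euclid R n), forall x : euclid R n, enorm x <= B ->
    exists2 c, c \in cs & mdist x c <= eta.
Proof.
move=> eta0.
have [delta delta0 etaE] : exists2 delta : R, 0 < delta & eta = delta * n.+1%:R.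
  by exists (eta / n.+1%:R); rewrite ?divr_gt0// mulfVK.
pose m := (Num.truncn (2 * B / delta)).+1.
pose c (f : {ffun 'I_n -> 'I_m}) : euclid R n := \row_i ((f i)%:R * delta - B).
exists [seq c f | f : {ffun 'I_n -> 'I_m}] => x xB.
have xiB i : `|x 0 i| <= B.
  apply: le_trans xB; rewrite -sqrtr_sqr ler_wsqrtr// (bigD1 i)//= lerDl.
  by rewrite sumr_ge0// => j _; exact: sqr_ge0.
pose k i := Num.truncn ((x 0 i + B) / delta).
have kP i : (k i)%:R * delta <= x 0 i + B < (k i).+1%:R * delta.
  have /truncn_itv : 0 <= (x 0 i + B) / delta.
    by rewrite divr_ge0 ?(ltW delta0)//; have := xiB i; rewrite ler_norml => /andP[]; lra.
  by rewrite ler_pdivlMr// ltr_pdivrMr.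
have km i : (k i < m)%N.
  rewrite ltnS le_truncn// ler_pM2r ?invr_gt0//.
  by have := xiB i; rewrite ler_norml => /andP[]; lra.
exists (c [ffun i => Ordinal (km i)]); first exact: codom_f.
rewrite mdist_euclid -(@ler_pXn2r _ 2)// ?nnegrE ?enorm_ge0 ?(ltW eta0)//.
rewrite enorm_sqr etaE.
apply: (@le_trans _ _ (\sum_(i < n) delta ^+ 2)).
  apply: ler_sum => i _; rewrite !mxE ffunE/=.
  have := kP i; rewrite -natr1 => /andP[]; set t := _%:R => ? ?; nra.
rewrite sumr_const card_ord -[leLHS]mulr_natr exprMn.
apply: ler_wpM2l; first exact: sqr_ge0.
by rewrite -natrX ler_nat (leq_trans (leqnSn n))// leq_pmulr.
Qed.

(** At large radii X is conic up to a relative error eps. Cover the unit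
    ball by finitely many balls of radius eps / 2 with centres c. For each
    c the set of radii r at which X meets the ball of centre r c and radius
    eps r / 2 is a definable subset of the line, hence eventually constant;
    beyond a common radius r0, if the direction c is approached by X at one
    radius then it is approached at all of them. For an arbitrary closed
    set this fails: branches may start and end at sparser and sparser
    radii. *)
Lemma asymptotically_conic (R : realType) (O : omin_structure R) (q : nat)
    (X : set (euclid R q)) (eps : R) : definable O X -> 0 < eps ->
  exists2 r0 : R, 0 < r0 & forall x (s : R), X x -> r0 <= enorm x -> r0 <= s ->
    exists2 y, X y & enorm y = s /\ enorm (y - (s / enorm x) *: x) <= eps * s.
Proof.
move=> dX eps0; have e20 : 0 < eps / 2 by rewrite divr_gt0.
have [cs csP] := finite_net q 1 e20.
pose A c : set (euclid R 1) := [set r | exists2 x, X x &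
  enorm x = r 0 0 /\ enorm (x - r 0 0 *: c) ^+ 2 <= (eps / 2) ^+ 2 * r 0 0 ^+ 2].
have [r0 r00 r0P] : exists2 r0 : R, 0 < r0 & forall c, c \in cs ->
    forall r s : euclid R 1, r0 <= r 0 0 -> r0 <= s 0 0 -> A c r -> A c s.
  elim: cs {csP} => [|c cs [r0 r00 IH]]; first by exists 1.
  have [r1 r1P] := definable_eventually (definable_near_ray c ((eps / 2) ^+ 2) dX).
  exists (Num.max r0 r1); first by rewrite lt_max r00.
  move=> d; rewrite inE => /predU1P[->|dcs] r s; rewrite !ge_max.
    move=> /andP[_ r1r] /andP[_ r1s] Ar.
    case: r1P => r1P; [exact: r1P|by case: (r1P _ r1r)].
  by move=> /andP[r0r _] /andP[r0s _]; exact: IH.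
exists r0 => // x s Xx r0x r0s.
have x0 : 0 < enorm x by exact: lt_le_trans r0x.
have s0 : 0 < s by exact: lt_le_trans r0s.
pose u : euclid R q := (enorm x)^-1 *: x.
have [|c ccs uc] := csP u.
  by rewrite /u enormZ ger0_norm ?invr_ge0 ?(ltW x0)// mulVf ?(gt_eqF x0).
have : A c (const_mx (enorm x)).
  exists x => //; rewrite mxE; split=> //.
  rewrite -exprMn ler_pXn2r ?nnegrE ?enorm_ge0 ?(mulr_ge0 (ltW e20) (ltW x0))//.
  have -> : x - enorm x *: c = enorm x *: (u - c).
    by rewrite scalerBr scalerA divff ?gt_eqF// scale1r.
  by rewrite enormZ ger0_norm ?(ltW x0)// mulrC ler_pM2r.
move=> /(r0P c ccs (const_mx (enorm x)) (const_mx s)); rewrite !mxE.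
move=> /(_ r0x r0s)[y Xy]; rewrite mxE -exprMn => -[ys].
rewrite ler_pXn2r ?nnegrE ?enorm_ge0 ?(mulr_ge0 (ltW e20) (ltW s0))// => yc.
exists y => //; split=> //.
have -> : y - (s / enorm x) *: x = (y - s *: c) + s *: (c - u).
  by rewrite scalerBr scalerA addrA subrK.
apply: le_trans (ler_enormD _ _) _.
rewrite enormZ ger0_norm ?(ltW s0)// -[c - u]opprB enormN.
have := uc; rewrite mdist_euclid; move: (enorm (u - c)) => d dle; nra.
Qed.

(** * Chains, limits of paths and the closure of the image *)

Lemma closure_metricP (R : realType) (M : metricType R) (S : set M) (u : M) :
  closure S u <-> forall e : R, 0 < e -> exists2 v, S v & mdist u v < e.
Proof.
split=> [Su e e0|Su B /nbhs_ballP[e /= e0 eB]].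
  have [v [Sv]] := Su _ (nbhsx_ballx u e e0).
  by rewrite ballEmdist; exists v.
by have [v Sv uv] := Su e e0; exists v; split=> //; apply: eB; rewrite ballEmdist.
Qed.

(** The eta-neighbourhoods of E and of its complement in X are open, and
    they exhibit E as relatively open and relatively closed. *)
Lemma connected_chain (R : realType) (M : metricType R) (X E : set M) (eta : R) :
  connected X -> 0 < eta -> E `<=` X -> E !=set0 ->
  (forall y z, X y -> X z -> mdist y z < eta -> E y -> E z) -> E = X.
Proof.
move=> Xc eta0 EX E0 Estep.
have thick (P : set M) : open [set z | exists2 y, P y & mdist y z < eta].
  rewrite openE => z [y Py yz]; apply/nbhs_ballP.
  exists (eta - mdist y z) => /=; first by rewrite subr_gt0.
  move=> t; rewrite ballEmdist/= => zt; exists y => //.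
  by apply: le_lt_trans (metric_triangle y z t) _; lra.
have self (y : M) : mdist y y < eta by rewrite mdistxx.
apply: Xc => //.
- exists [set z | exists2 y, E y & mdist y z < eta]; first exact: thick.
  apply/seteqP; split=> [y Ey|z [Xz [y Ey yz]]].
    by split; [exact: EX|exists y].
  exact: Estep (EX _ Ey) Xz yz Ey.
- exists (~` [set z | exists2 y, (X `\` E) y & mdist y z < eta]).
    exact/open_closedC/thick.
  apply/seteqP; split=> [z Ez|z [Xz nz]].
    split; first exact: EX.
    move=> [y [Xy nEy] yz]; apply: nEy; apply: Estep (EX _ Ez) Xy _ Ez.
    by rewrite metric_sym.
  by apply: contrapT => nEz; apply: nz; exists z.
Qed.

(** Infinitely many paths are concatenated towards their limit point z. The
    result is parametrised from z: it runs from u (k + 1) to u k during the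
    time interval [psi (k + 1), psi k]. The approximation G n waits at u n
    until the time psi n; at each positive time the sequence G is
    eventually stationary, and its limit is completed by z at time 0. *)
Lemma lip_path_lim (R : realType) (M : metricType R) (S : set M) (z : M)
    (u : nat -> M) (psi : nat -> R) :
  S z -> (forall k, 0 < psi k) ->
  (forall k, lip_path S (u k) (u k.+1) (psi k - psi k.+1)) ->
  (forall e, 0 < e -> exists n, psi n < e /\ mdist z (u n) < e) ->
  lip_path S z (u 0%N) (psi 0%N).
Proof.
move=> Sz psi0 upath ulim.
have psiS k : psi k.+1 <= psi k by rewrite -subr_ge0; case: (upath k).
have psi_le k n : (k <= n)%N -> psi n <= psi k.
  by move=> /subnKC <-; elim: (n - k)%N => [|j]; rewrite ?addn0// addnS; apply: le_trans.
have /choice[f fP] k : exists f : R -> M, [/\ forall t, S (f t),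
    forall s t, mdist (f s) (f t) <= `|s - t|,
    forall t, t <= psi k.+1 -> f t = u k.+1 & f (psi k) = u k].
  have [l0 [h [hS hlip h0 hl]]] := lip_path_sym (upath k).
  exists (fun t => h (Num.max 0 (t - psi k.+1))); split=> //.
  - move=> s t; apply: le_trans (hlip _ _) _; apply: le_trans (max_lip _ _ _) _.
    by rewrite opprB addrA subrK.
  - by move=> t tk; rewrite max_l// subr_le0.
  - by rewrite max_r.
pose G n := iteri n (fun k g t => if t <= psi k then f k t else g t) (fun=> u 0%N).
have GP n : [/\ forall t, S (G n t), forall s t, mdist (G n s) (G n t) <= `|s - t|
    & forall t, t <= psi n -> G n t = u n].
  elim: n => [|n [IS Ilip Iu]].
    split=> // [t|s t]; last by rewrite mdistxx.
    by have [_ [h [hS _ h0 _]]] := upath 0%N; rewrite /G/= -h0.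
  have [fS flip fu fk] := fP n; split=> [t|s t|t tn].
  - by rewrite /G iteriS; case: ifP => _; [exact: fS|exact: IS].
  - by apply: (@lip_path_glue _ _ (psi n) (f n) (G n)) => //; rewrite fk Iu.
  - by rewrite /G iteriS (le_trans tn)// fu.
have Gstep k t : psi k <= t -> G k.+1 t = G k t.
  move=> kt; rewrite [G k.+1]/G iteriS; case: ifPn => // tk.
  have <- : psi k = t by apply/eqP; rewrite eq_le kt.
  by have [_ _ _ ->] := fP k; have [_ _ ->] := GP k.
have Gstable k n t : (k <= n)%N -> psi k <= t -> G n t = G k t.
  move=> /subnKC <- kt; elim: (n - k)%N => [|j IH]; rewrite ?addn0// addnS Gstep//.
  by apply: le_trans kt; apply: psi_le; exact: leq_addr.
have GE k n t : psi k <= t -> psi n <= t -> G n t = G k t.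
  move=> kt nt; case: (leqP k n) => [kn|/ltnW nk]; first exact: Gstable.
  by apply/esym/Gstable.
have /choice[kap kapP] t : exists k, 0 < t -> psi k <= t.
  have [/ulim[n [/ltW nt _]]|t0] := boolP (0 < t); first by exists n.
  by exists 0%N.
pose g t := if 0 < t then G (kap t) t else z.
have gE k t : psi k <= t -> g t = G k t.
  move=> kt; have t0 : 0 < t by exact: lt_le_trans kt.
  by rewrite /g t0; apply: GE => //; exact: kapP.
have gz t : 0 < t -> mdist z (g t) <= t.
  move=> t0; apply/ler_addgt0Pr => e e0.
  have [|n []] := ulim (Num.min e t); first by rewrite lt_min e0.
  rewrite !lt_min => /andP[_ nt] /andP[zu _].
  rewrite (gE n _ (ltW nt)); apply: (mdist_trans (y := u n)).
  have [_ Glip Gu] := GP n; have := Glip (psi n) t.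
  rewrite (Gu (psi n))// ler0_norm; last lra.
  by have := psi0 n; lra.
split; first exact: ltW.
exists g; split.
- by move=> t; rewrite /g; case: ifP => // _; have [] := GP (kap t).
- suff glip s t : s <= t -> mdist (g s) (g t) <= t - s.
    move=> s t; case: (leP s t) => st; first by rewrite ler0_norm; [rewrite opprB glip|lra].
    by rewrite metric_sym ger0_norm ?glip; lra.
  move=> st; case: (leP s 0) => s0.
    have -> : g s = z by rewrite /g ltNge s0.
    case: (leP t 0) => t0; first by rewrite /g ltNge t0 mdistxx; lra.
    by have := gz t t0; lra.
  have := kapP s s0; set k := kap s => ks.
  rewrite (gE k)// (gE k t)//; last lra.
  by have [_ Glip _] := GP k; apply: le_trans (Glip _ _) _; rewrite ler0_norm; lra.
- by rewrite /g ltxx.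
- by rewrite (gE 0%N)//; have [_ _ ->] := GP 0%N.
Qed.

Section closure_of_image.
Context {R : realType} {q : nat} (X : set (euclid R q)).

(** Being within half the distance 2 / bracket x to the north pole prevents
    the bracket from changing by more than a factor 2. *)
Lemma bracket_near (x y : euclid R q) :
  mdist (inv_stereo x) (inv_stereo y) <= (bracket x)^-1 ->
  bracket y <= 2 * bracket x /\ bracket x <= 2 * bracket y.
Proof.
have x0 := bracket_gt0 x; have y0 := bracket_gt0 y => xy.
have := metric_triangle (inv_stereo x) (inv_stereo y) north.
have := metric_triangle (inv_stereo y) (inv_stereo x) north.
rewrite (metric_sym (inv_stereo y) (inv_stereo x)) !mdist_north => yx' xy'.
split; rewrite -lef_pV2 ?posrE ?mulr_gt0// invfM; lra.
Qed.

Lemma mdist_euclid_le (x y : euclid R q) :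
  mdist (inv_stereo x) (inv_stereo y) <= (bracket x)^-1 ->
  mdist x y <= bracket x ^+ 2 * mdist (inv_stereo x) (inv_stereo y).
Proof.
move=> /bracket_near[yx _]; have x0 := bracket_gt0 x; have y0 := bracket_gt0 y.
have -> : mdist x y
    = bracket x * bracket y / 2 * mdist (inv_stereo x) (inv_stereo y).
  by rewrite mdist_inv_stereo; field; rewrite !gt_eqF.
apply: ler_wpM2r; [exact: mdist_ge0|nra].
Qed.

Lemma closure_inv_stereo x : closed X -> closure (inv_stereo @` X) (inv_stereo x) <-> X x.
Proof.
move=> Xclosed; split=> [/closure_metricP cX|Xx]; last by apply: subset_closure; exists x.
apply: Xclosed; apply/closure_metricP => e e0.
have x0 := bracket_gt0 x.
pose d := Num.min (bracket x)^-1 (e / bracket x ^+ 2).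
have [|_ [y Xy <-]] := cX d; first by rewrite lt_min invr_gt0 x0 divr_gt0 ?exprn_gt0.
rewrite lt_min => /andP[/ltW xy xye]; exists y => //.
apply: le_lt_trans (mdist_euclid_le xy) _.
by rewrite mulrC -ltr_pdivlMr// exprn_gt0.
Qed.

Lemma closure_north : closure (inv_stereo @` X) north <->
  forall r : R, exists2 x, X x & r <= enorm x.
Proof.
split=> [/closure_metricP cX r|Xr].
  pose d := 2 / (1 + `|r|); have r0 : 0 < 1 + `|r| by rewrite ltr_wpDr.
  have [|_ [x Xx <-]] := cX d; first exact: divr_gt0.
  rewrite metric_sym mdist_north /d ltr_pM2l// ltf_pV2 ?posrE ?bracket_gt0// => rx.
  exists x => //; have := bracket_le (lexx (enorm x)); have := ler_norm r; lra.
apply/closure_metricP => e e0; have [x Xx ex] := Xr (2 / e + 1).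
exists (inv_stereo x); first by exists x.
rewrite metric_sym mdist_north ltr_pdivrMr ?bracket_gt0// mulrC -ltr_pdivrMr//.
by have := enorm_le_bracket x; lra.
Qed.

End closure_of_image.

(** * From the Euclidean space to the sphere *)

(** By the inequality of Bernoulli, the powers grow at least linearly. *)
Lemma exprn_unbounded (R : realType) (eps M : R) : 0 < eps ->
  exists n : nat, M < (1 + eps) ^+ n.
Proof.
move=> eps0; have bern n : 1 + n%:R * eps <= (1 + eps) ^+ n.
  elim: n => [|n IH]; first by rewrite mul0r addr0.
  rewrite exprS -natr1; have : 0 <= n%:R :> R by []; nra.
have [M0|M0] := leP 0 (M / eps); last first.
  exists 0%N; rewrite expr0; move: M0; rewrite ltr_pdivrMr// mul0r; lra.
exists (Num.truncn (M / eps)).+1; apply: lt_le_trans (bern _).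
have /andP[_] := truncn_itv M0; rewrite ltr_pdivrMr//; lra.
Qed.

Lemma LNE_lip_path1 (R : realType) (M : metricType R) (S : set M) : LNE S ->
  exists2 L : R, 1 <= L & forall x y, S x -> S y -> lip_path S x y (L * mdist x y).
Proof.
move=> /LNE_lip_path[L L0 SL]; exists (1 + L) => [|x y Sx Sy]; first lra.
apply: lip_path_le (SL x y Sx Sy).
by rewrite ler_wpM2r ?mdist_ge0//; lra.
Qed.

Section forward.
Context {R : realType} {q : nat} (X : set (euclid R q)).
Local Notation S := (closure (inv_stereo @` X)).

Lemma image_sub_closure x : X x -> S (inv_stereo x).
Proof. by move=> Xx; apply: subset_closure; exists x. Qed.

Lemma lip_path_inv_stereo2 x y l :
  lip_path X x y l -> lip_path S (inv_stereo x) (inv_stereo y) (2 * l).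
Proof.
apply: lip_path_map => // z z' _ _ Xz Xz'; split; first exact: image_sub_closure.
rewrite mdist_inv_stereo ler_pdivrMr ?mulr_gt0 ?bracket_gt0//.
have := bracket_ge1 z; have := bracket_ge1 z'; have := mdist_ge0 z z'.
move: (bracket z) (bracket z') (mdist _ _) => w w' d d0 w'1 w1.
have : 1 <= w * w' by nra.
by move: (w * w') => p p1; nra.
Qed.

(** The bracket is 1-Lipschitz, so it stays above half its initial value
    along a path this short. *)
Lemma lip_path_inv_stereo x y l : l <= bracket x / 2 -> lip_path X x y l ->
  lip_path S (inv_stereo x) (inv_stereo y) (8 / bracket x ^+ 2 * l).
Proof.
move=> lx; have w0 := bracket_gt0 x.
apply: lip_path_map; first by rewrite divr_gt0 ?exprn_gt0.
move=> z z' xz xz' Xz Xz'; split; first exact: image_sub_closure.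
rewrite mdist_inv_stereo.
have h t : mdist x t <= l -> bracket x / 2 <= bracket t.
  by have := bracket_lip x t; lra.
have wz := h _ xz; have wz' := h _ xz'.
have wzz' : bracket x ^+ 2 / 4 <= bracket z * bracket z' by nra.
rewrite ler_pdivrMr ?mulr_gt0 ?bracket_gt0//.
have -> : 2 * mdist z z' = 8 / bracket x ^+ 2 * mdist z z' * (bracket x ^+ 2 / 4).
  by field; rewrite gt_eqF.
by apply: ler_wpM2l wzz'; rewrite mulr_ge0 ?mdist_ge0// divr_ge0 ?sqr_ge0.
Qed.

End forward.

Section forward_main.
Context {R : realType} (O : omin_structure R) {q : nat} (X : set (euclid R q)).

Local Notation S := (closure (inv_stereo @` X)).

(** The images of the points of X reach the north pole at a cost comparable
    to their distance to it. Far out, asymptotic conicity gives in X a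
    point whose norm is 1 + eps times larger, at Euclidean distance O(eps
    |x|). As eps is small compared with 1 / L, the path of X joining the
    two stays at distance of order |x| from the origin, so that its
    spherical length is O(1 / |x|). Iterating, the lengths form a geometric
    series. The points of bounded norm are first sent to a fixed point far
    out. *)
Lemma lip_path_north (L : R) : definable O X -> 1 <= L ->
  (forall x y, X x -> X y -> lip_path X x y (L * mdist x y)) ->
  (forall r : R, exists2 x, X x & r <= enorm x) ->
  exists2 C : R, 0 < C & forall x, X x ->
    lip_path S (inv_stereo x) north (C / bracket x).
Proof.
move=> dX L1 XL Xunb; pose eps : R := (8 * L)^-1.
have eps0 : 0 < eps by rewrite invr_gt0 mulr_gt0//; lra.
have epsL : L * eps = 8^-1 by rewrite /eps; field; lra.
have eps8 : eps <= 8^-1 by nra.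
have [r0 r00 r0P] := asymptotically_conic dX eps0.
pose r1 := Num.max r0 1.
have r11 : 1 <= r1 by rewrite le_max lexx orbT.
have r01 : r0 <= r1 by rewrite le_max lexx.
have SN : S north by apply/closure_north.
(* C1 / |x| is the sum of the geometric series with first term 3 / |x| and
   ratio 1 / (1 + eps), so each step is paid by a decrease of C1 / |x|. *)
pose C1 := 3 * (1 + eps) / eps.
have C10 : 0 < C1 by rewrite divr_gt0// mulr_gt0//; lra.
have step x : exists y, X x -> r1 <= enorm x -> [/\ X y,
    enorm y = (1 + eps) * enorm x &
    lip_path S (inv_stereo x) (inv_stereo y) (C1 / enorm x - C1 / enorm y)].
  have [Xx|nXx] := pselect (X x); last by exists x.
  have [xr1|] := boolP (r1 <= enorm x); last by exists x.
  have x0 : 0 < enorm x by lra.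
  have [||y Xy [yx yd]] := r0P x ((1 + eps) * enorm x) Xx; [lra|nra|].
  exists y => _ _; split=> //.
  have dxy : mdist x y <= 3 * eps * enorm x.
    apply: (mdist_trans (y := (1 + eps) *: x)).
    rewrite !mdist_euclid -[in X in _ + X]opprB enormN.
    rewrite mulfK ?gt_eqF// in yd.
    have -> : x - (1 + eps) *: x = - (eps *: x).
      by rewrite scalerDl scale1r opprD addrA subrr add0r.
    rewrite enormN enormZ (ger0_norm (ltW eps0)).
    have : 0 <= eps * enorm x * (1 - eps) by rewrite !mulr_ge0//; lra.
    by lra.
  have lx : 3 / 8 * enorm x <= bracket x / 2.
    by have := enorm_le_bracket x; lra.
  have xy : lip_path X x y (3 / 8 * enorm x).
    by apply: lip_path_le (XL _ _ Xx Xy); nra.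
  apply: lip_path_le (lip_path_inv_stereo lx xy).
  rewrite yx.
  have -> : C1 / enorm x - C1 / ((1 + eps) * enorm x) = 3 / enorm x.
    by rewrite /C1; field; rewrite !gt_eqF//; lra.
  have w0 := bracket_gt0 x.
  have -> : 8 / bracket x ^+ 2 * (3 / 8 * enorm x) = 3 * enorm x / bracket x ^+ 2.
    by field; rewrite gt_eqF.
  rewrite ler_pdivrMr ?exprn_gt0// mulrAC ler_pdivlMr// bracket_sqr; nra.
have [f fP] := choice step.
have far x : X x -> r1 <= enorm x ->
    lip_path S (inv_stereo x) north (C1 / enorm x).
  move=> Xx xr1; have x0 : 0 < enorm x by lra.
  apply: lip_path_sym; pose u k := iter k f x.
  have uP k : X (u k) /\ enorm (u k) = (1 + eps) ^+ k * enorm x.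
    elim: k => [|k [Xk ek]]; first by rewrite mul1r.
    have [|Xk1 -> _] := fP _ Xk.
      by rewrite ek; have := @exprn_ege1 _ k (1 + eps); nra.
    by rewrite exprS -mulrA ek.
  have e1 k : 1 <= (1 + eps) ^+ k by apply: exprn_ege1; lra.
  have u0 k : r1 <= enorm (u k) by have [_ ->] := uP k; have := e1 k; nra.
  apply: (@lip_path_lim _ _ S north (inv_stereo \o u) (fun k => C1 / enorm (u k))) => //.
  - by move=> k; rewrite divr_gt0//; have := u0 k; lra.
  - by move=> k; have [] := fP _ (uP k).1 (u0 k).
  - move=> e e0; have [n nP] := exprn_unbounded ((C1 + 2) / e / enorm x) eps0.
    exists n; have un0 : 0 < enorm (u n) by have := u0 n; lra.
    have Cn : (C1 + 2) / enorm (u n) < e.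
      have [_ ->] := uP n; rewrite ltr_pdivrMr ?mulr_gt0//; last by have := e1 n; lra.
      by move: nP; rewrite ltr_pdivrMr// ltr_pdivrMr//; lra.
    split; first by apply: le_lt_trans Cn; rewrite ler_pM2r ?invr_gt0//; lra.
    rewrite metric_sym mdist_north; apply: le_lt_trans Cn.
    apply: ler_pM => //; [by rewrite invr_ge0 (ltW (bracket_gt0 _))|by lra|].
    by rewrite lef_pV2 ?posrE ?bracket_gt0// enorm_le_bracket.
have [xs Xxs xsr1] := Xunb r1.
pose K := 2 * L * (r1 + enorm xs) + C1 / enorm xs.
have xs0 : 0 < enorm xs by lra.
have K0 : 0 < K.
  by apply: addr_gt0; [rewrite !mulr_gt0//; lra|exact: divr_gt0].
exists (2 * C1 + K * (1 + r1)) => [|x Xx].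
  by rewrite addr_gt0// mulr_gt0//; lra.
have wx0 := bracket_gt0 x.
have KC : 0 <= K * (1 + r1) by rewrite mulr_ge0//; lra.
have [xr1|xr1] := leP r1 (enorm x).
  apply: lip_path_le (far x Xx xr1).
  rewrite ler_pdivlMr// mulrAC ler_pdivrMr; last lra.
  have := bracket_le (lexx (enorm x)); nra.
have p1 := lip_path_inv_stereo2 (XL _ _ Xx Xxs).
apply: lip_path_le (lip_path_trans p1 (far xs Xxs xsr1)).
have dx : mdist x xs <= r1 + enorm xs.
  by have := ler_enormD x (- xs); rewrite enormN mdist_euclid; lra.
apply: (@le_trans _ _ K).
  by rewrite /K lerD2r mulrA ler_wpM2l//; lra.
rewrite ler_pdivlMr//; have := bracket_le (ltW xr1); nra.
Qed.

(** If X is bounded, the chart is bi-Lipschitz on it. Otherwise the pole is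
    adherent. Two points whose distance is small compared with their
    brackets are joined by the image of a path of X. For the others, the
    spherical distance is at least of order 1 / bracket x + 1 / bracket y,
    and the detour through the pole is efficient. *)
Lemma LNE_inv_stereo : definable O X -> closed X -> LNE X -> LNE S.
Proof.
move=> dX Xcl /LNE_lip_path1[L L1 XL]; apply/LNE_lip_path.
have mdistE (x y : euclid R q) : mdist x y
    = bracket x * bracket y / 2 * mdist (inv_stereo x) (inv_stereo y).
  by rewrite mdist_inv_stereo; field; rewrite !gt_eqF ?bracket_gt0.
have [Xunb|] := pselect (forall r : R, exists2 x, X x & r <= enorm x); last first.
  move=> /existsNP[B XB].
  have wB x : X x -> bracket x <= 1 + `|B|.
    move=> Xx; apply: bracket_le; apply: le_trans (ler_norm B); apply: ltW.
    by rewrite ltNge; apply/negP => Bx; apply: XB; exists x.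
  have B0 := normr_ge0 B.
  exists (L * (1 + `|B|) ^+ 2) => [|u v Su Sv].
    by rewrite mulr_gt0 ?exprn_gt0//; lra.
  have SX w : S w -> exists2 x, X x & inv_stereo x = w.
    move=> Sw; have [wN|/inv_stereo_surj[x xw]] := pselect (w = north).
      by exfalso; apply: XB; apply: (closure_north X).1; rewrite -wN.
    by exists x => //; apply/(closure_inv_stereo _ Xcl); rewrite xw.
  have [x Xx <-] := SX _ Su; have [y Xy <-] := SX _ Sv.
  apply: lip_path_le (lip_path_inv_stereo2 (XL _ _ Xx Xy)).
  have -> : 2 * (L * mdist x y) = L * (bracket x * bracket y)
      * mdist (inv_stereo x) (inv_stereo y) by rewrite mdistE; field.
  apply: ler_wpM2r; first exact: mdist_ge0.
  apply: ler_wpM2l; first lra.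
  have := wB x Xx; have := wB y Xy; have := bracket_gt0 x; have := bracket_gt0 y.
  by move: (bracket x) (bracket y) (1 + _) => w w' b; nra.
have [C C0 XC] := lip_path_north dX L1 XL Xunb.
have SXN w : S w -> w = north \/ exists2 x, X x & inv_stereo x = w.
  move=> Sw; have [wN|/inv_stereo_surj[x xw]] := pselect (w = north); first by left.
  by right; exists x => //; apply/(closure_inv_stereo _ Xcl); rewrite xw.
have SN : S north by apply/closure_north.
pose K := C * (4 * L + 1) + 6 * L.
have KC : C <= K by rewrite /K; nra.
have K0 : 0 < K by lra.
have XNK x : X x -> lip_path S (inv_stereo x) north (K * mdist (inv_stereo x) north).
  move=> Xx; apply: lip_path_le (XC x Xx).
  rewrite mdist_north mulrA ler_pM2r ?invr_gt0 ?bracket_gt0//; lra.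
exists K => // u v /SXN[->|[x Xx <-]] /SXN[->|[y Xy <-]].
- by rewrite mdistxx mulr0; exact: lip_path_refl.
- by rewrite metric_sym; apply: lip_path_sym; exact: XNK.
- exact: XNK.
have wx := bracket_gt0 x; have wy := bracket_gt0 y.
have yx := bracket_lip y x; rewrite (metric_sym y x) in yx.
have xy0 := mdist_ge0 x y; have sxy0 := mdist_ge0 (inv_stereo x) (inv_stereo y).
have [near|far] := leP (L * mdist x y) (bracket x / 2).
  apply: lip_path_le (lip_path_inv_stereo near (XL _ _ Xx Xy)).
  apply: (@le_trans _ _ (6 * L * mdist (inv_stereo x) (inv_stereo y))); last first.
    by rewrite ler_wpM2r// /K lerDr mulr_ge0//; lra.
  have yx' : bracket y <= 3 / 2 * bracket x by nra.
  have -> : 8 / bracket x ^+ 2 * (L * mdist x y) =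
      4 * L * (bracket y / bracket x) * mdist (inv_stereo x) (inv_stereo y).
    by rewrite mdistE; field; rewrite gt_eqF.
  apply: ler_wpM2r => //.
  have : bracket y / bracket x <= 3 / 2 by rewrite ler_pdivrMr.
  by move: (bracket y / _) => t; nra.
apply: lip_path_le (lip_path_trans (XC x Xx) (lip_path_sym (XC y Xy))).
apply: (@le_trans _ _ (C * (4 * L + 1) * mdist (inv_stereo x) (inv_stereo y))); last first.
  by rewrite ler_wpM2r// /K lerDl mulr_ge0//; lra.
have -> : C / bracket x + C / bracket y
    = C * ((bracket x + bracket y) / (bracket x * bracket y)).
  by field; rewrite !gt_eqF.
rewrite -mulrA ler_pM2l// mdist_inv_stereo [leRHS]mulrA.
rewrite ler_pM2r ?invr_gt0 ?mulr_gt0//; nra.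
Qed.

End forward_main.

(** * From the sphere to the Euclidean space *)

Section backward.
Context {R : realType} (O : omin_structure R) {q : nat} (X : set (euclid R q)).
Local Notation S := (closure (inv_stereo @` X)).

(** A path of this length covers at most half the distance to the pole, so
    it lies in the image of the chart and the brackets along it are at most
    doubled. *)
Lemma lip_path_stereo x y l : closed X -> l <= (bracket x)^-1 ->
  lip_path S (inv_stereo x) (inv_stereo y) l ->
  lip_path X x y (2 * bracket x ^+ 2 * l).
Proof.
move=> Xcl lx; have w0 := bracket_gt0 x.
have /choice[f fP] (u : sphere R q) :
    exists z : euclid R q, u <> north -> inv_stereo z = u.
  have [uN|/inv_stereo_surj[z zu]] := pselect (u = north); first by exists 0.
  by exists z.
have fK z : f (inv_stereo z) = z.
  by apply: inv_stereo_inj; apply: fP; exact: north_neq_inv_stereo.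
rewrite -{2}[x]fK -{2}[y]fK.
apply: lip_path_map; first by rewrite mulr_gt0 ?exprn_gt0.
have h u : mdist (inv_stereo x) u <= l -> inv_stereo (f u) = u.
  move=> ul; apply: fP => uN; move: ul; rewrite uN mdist_north => ul.
  have : 2 / bracket x <= 1 / bracket x by rewrite div1r; lra.
  by rewrite ler_pM2r ?invr_gt0//; lra.
move=> u v ul vl Su Sv; have eu := h _ ul; have ev := h _ vl.
rewrite -eu -ev in ul vl Su Sv *; rewrite !fK.
move: (f u) (f v) ul vl Su Sv {eu ev} => z z' zl z'l Sz Sz'.
split; first exact/(closure_inv_stereo _ Xcl).
have [wz _] := bracket_near (le_trans zl lx).
have [wz' _] := bracket_near (le_trans z'l lx).
have wz0 := bracket_gt0 z; have wz'0 := bracket_gt0 z'.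
have -> : mdist z z'
    = bracket z * bracket z' / 2 * mdist (inv_stereo z) (inv_stereo z').
  by rewrite mdist_inv_stereo; field; rewrite !gt_eqF.
apply: ler_wpM2r; [exact: mdist_ge0|nra].
Qed.

(** The efficient spherical path between points that are close relative to
    their brackets avoids the pole and can be projected to X. *)
Lemma lip_path_local (L : R) x y : closed X -> 1 <= L ->
  (forall u v, S u -> S v -> lip_path S u v (L * mdist u v)) ->
  X x -> X y -> 2 * L * mdist x y <= bracket y ->
  lip_path X x y (8 * L * mdist x y).
Proof.
move=> Xcl L1 SL Xx Xy xy.
have wx := bracket_gt0 x; have wy := bracket_gt0 y.
have sl : L * mdist (inv_stereo x) (inv_stereo y) <= (bracket x)^-1.
  rewrite mdist_inv_stereo invfM mulrA.
  rewrite -[leRHS]mul1r -[X in _ <= X * _](mulfV (_ : bracket y != 0)) ?gt_eqF//.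
  rewrite mulrA mulrAC; do 2!(rewrite ler_pM2r ?invr_gt0//); lra.
have sxy0 := mdist_ge0 (inv_stereo x) (inv_stereo y).
have near : mdist (inv_stereo x) (inv_stereo y) <= (bracket x)^-1 by nra.
have [_ wxy] := bracket_near near.
have := lip_path_stereo Xcl sl (SL _ _ _ _).
move=> /(_ ((closure_inv_stereo _ Xcl).2 Xx) ((closure_inv_stereo _ Xcl).2 Xy)).
apply: lip_path_le.
have -> : 2 * bracket x ^+ 2 * (L * mdist (inv_stereo x) (inv_stereo y))
    = 4 * L * mdist x y * (bracket x / bracket y).
  by rewrite mdist_inv_stereo; field; rewrite !gt_eqF.
rewrite (_ : 8 * L * mdist x y = 4 * L * mdist x y * 2); last by ring.
apply: ler_wpM2l; last by rewrite ler_pdivrMr.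
by rewrite mulr_ge0 ?mdist_ge0//; lra.
Qed.

(** After the local estimate, only pairs with |x - y| of order bracket x +
    bracket y remain, and it suffices to join every x to a base point at
    cost O(bracket x). Asymptotic conicity provides steps towards the
    origin that divide the norm by 1 + eps; their lengths add up to O(|x|)
    and lead to bounded norm. There a finite net leaves finitely many
    points to be joined to the base point, which is possible because X is
    connected and points at distance less than eta are always joined. *)
Lemma LNE_of_inv_stereo : definable O X -> closed X -> connected X ->
  LNE S -> LNE X.
Proof.
move=> dX Xcl Xc /LNE_lip_path1[L L1 SL]; apply/LNE_lip_path.
have loc x y := @lip_path_local L x y Xcl L1 SL.
have [[x0 Xx0]|X0] := pselect (exists x, X x); last first.
  by exists 1 => // x y Xx; case: X0; exists x.
pose eta : R := (2 * L)^-1.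
have eta0 : 0 < eta by rewrite invr_gt0; lra.
have etaL : 2 * L * eta = 1 by rewrite mulfV//; lra.
have loc' x y : X x -> X y -> mdist x y <= eta -> lip_path X x y 4.
  move=> Xx Xy xy; have d0 := mdist_ge0 x y.
  have xy1 : 2 * L * mdist x y <= 1 by nra.
  apply: lip_path_le (loc x y Xx Xy _); first lra.
  exact: le_trans (bracket_ge1 y).
have conn x : X x -> exists l, lip_path X x x0 l.
  pose E := [set x | exists l, lip_path X x x0 l].
  have EX : E `&` X = X.
    apply: (connected_chain Xc eta0) => [y []//||y z Xy Xz yz [[l yl] _]].
      by exists x0; split=> //; exists 0; exact: lip_path_refl.
    split=> //; exists (4 + l); apply: lip_path_trans yl.
    by apply: loc' => //; rewrite metric_sym ltW.
  by move=> Xx; have [] : (E `&` X) x by rewrite EX.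
pose eps : R := eta / 2.
have eps0 : 0 < eps by rewrite divr_gt0.
have epsL : 4 * L * eps = 1 by rewrite /eps; lra.
have [r0 r00 r0P] := asymptotically_conic dX eps0.
have step x : X x -> (1 + eps) * r0 <= enorm x -> exists y,
    [/\ X y, enorm x = (1 + eps) * enorm y &
      lip_path X x y (16 * L * (enorm x - enorm y))].
  move=> Xx xr; have x_gt0 : 0 < enorm x by nra.
  pose s := enorm x / (1 + eps).
  have xs : enorm x = (1 + eps) * s by rewrite /s mulrC divfK// gt_eqF//; lra.
  have s0 : r0 <= s by move: xr; rewrite xs ler_pM2l//; lra.
  have [||y Xy [ys yd]] := r0P x s Xx; [nra|by []|].
  exists y; rewrite ys; split=> //.
  have dxy : mdist x y <= 2 * eps * s.
    apply: (mdist_trans (y := (s / enorm x) *: x)).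
    rewrite !mdist_euclid -[in X in _ + X]opprB enormN.
    have -> : x - (s / enorm x) *: x = (eps / (1 + eps)) *: x.
      rewrite -[in X in X - _](scale1r x) -scalerBl; congr (_ *: _).
      by rewrite /s; field; rewrite !gt_eqF//; lra.
    rewrite enormZ ger0_norm ?divr_ge0; try lra.
    have -> : eps / (1 + eps) * enorm x = eps * s by rewrite /s; field; lra.
    by lra.
  have d0 := mdist_ge0 x y; have s_gt0 : 0 < s by lra.
  apply: lip_path_le (loc x y Xx Xy _); first by rewrite xs; nra.
  have := enorm_le_bracket y; rewrite ys; nra.
pose r1 := (1 + eps) * r0.
have down n x : X x -> enorm x <= (1 + eps) ^+ n * r1 -> exists y,
    [/\ X y, enorm y <= r1 & lip_path X x y (16 * L * (enorm x - enorm y))].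
  elim: n x => [|n IH] x Xx xn.
    exists x; rewrite subrr mulr0; split=> //; last exact: lip_path_refl.
    by rewrite expr0 mul1r in xn.
  have [xr1|/ltW xr1] := leP (enorm x) r1.
    by exists x; rewrite subrr mulr0; split=> //; exact: lip_path_refl.
  have [y [Xy xy pxy]] := step x Xx xr1.
  have [|z [Xz zr pyz]] := IH y Xy.
    by move: xn; rewrite xy exprS -mulrA ler_pM2l//; lra.
  exists z; split=> //; apply: lip_path_le (lip_path_trans pxy pyz); lra.
have [K K0 KP] : exists2 K, 0 <= K & forall x, X x -> enorm x <= r1 ->
    lip_path X x x0 K.
  have [cs csP] := finite_net q r1 eps0.
  suff [K K0 KP] : exists2 K, 0 <= K & forall c, c \in cs -> forall x, X x ->
      mdist x c <= eta / 2 -> lip_path X x x0 K.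
    exists K => // x Xx /csP[c ccs xc]; exact: KP ccs _ Xx xc.
  elim: cs {csP} => [|c cs [K K0 IH]]; first by exists 0.
  have [l l0 lP] : exists2 l, 0 <= l & forall x, X x -> mdist x c <= eta / 2 ->
      lip_path X x x0 l.
    (* One point of X per ball of the net is enough: any other is joined to
       it. *)
    have [[p Xp pc]|np] := pselect (exists2 p, X p & mdist p c <= eta / 2); last first.
      by exists 0 => // x Xx xc; case: np; exists x.
    have [l pl] := conn p Xp; exists (4 + l) => [|x Xx xc].
      by case: pl; lra.
    apply: lip_path_trans pl; apply: loc' => //; apply: (mdist_trans (y := c)).
    by rewrite (metric_sym c); lra.
  exists (K + l); first exact: addr_ge0.
  move=> d; rewrite inE => /predU1P[->|dcs] x Xx xd.
    by apply: lip_path_le (lP x Xx xd); rewrite lerDr.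
  by apply: lip_path_le (IH d dcs x Xx xd); rewrite lerDl.
(* The cost 16 L (|x| - |y|) of the descent telescopes along the steps. *)
have base x : X x -> lip_path X x x0 ((16 * L + K) * bracket x).
  move=> Xx; have [n /ltW nP] := exprn_unbounded (enorm x / r1) eps0.
  have r10 : 0 < r1 by rewrite mulr_gt0//; lra.
  have [|y [Xy yr pxy]] := down n x Xx; first by rewrite -ler_pdivrMr.
  apply: lip_path_le (lip_path_trans pxy (KP y Xy yr)).
  have := enorm_le_bracket x; have := bracket_ge1 x; have := enorm_ge0 y; nra.
pose C := (16 * L + K) * (4 * L + 1).
have LK0 : 0 < 16 * L + K by lra.
exists (8 * L + C) => [|x y Xx Xy].
  by rewrite addr_gt0 ?mulr_gt0//; lra.
have d0 := mdist_ge0 x y.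
have [xy|xy] := leP (2 * L * mdist x y) (bracket y).
  apply: lip_path_le (loc x y Xx Xy xy); rewrite ler_wpM2r// lerDl.
  by rewrite mulr_ge0//; lra.
apply: lip_path_le (lip_path_trans (base x Xx) (lip_path_sym (base y Xy))).
rewrite -mulrDr; apply: (@le_trans _ _ (C * mdist x y)); last first.
  by rewrite ler_wpM2r// lerDr; lra.
rewrite /C -mulrA ler_pM2l//; have := bracket_lip x y; lra.
Qed.

End backward.

Theorem theorem6p2 (R : realType) (O : omin_structure R) (q : nat)
    (hq : (1 <= q)%N) (X : set (euclid R q))
    (Xclosed : closed X) (Xconnected : connected X) (Xdef : definable O X) :
  LNE X <-> LNE (closure (inv_stereo @` X)).
Proof.
split; first exact: LNE_inv_stereo Xdef Xclosed.
exact: LNE_of_inv_stereo Xdef Xclosed Xconnected.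
Qed.
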